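(* Let $f:\mathbb{R}^n\to\mathbb{R}$ be $k$-times differentiable (respectively, $k$-times continuously differentiable) on $\mathbb{R}^n$, and let $X$ be an $n\times n$ real symmetric matrix with distinct eigenvalues. Then $f\circ\lambda$ is $k$-times differentiable (respectively, $k$-times continuously differentiable) at $X$. Moreover, let $1\le s<k$ and suppose that there are $s$-tensor valued maps $\mathcal{A}_\sigma:\mathbb{R}^n\to T^{s,n}$, one for each $\sigma\in P^s$, each $(k-s)$-times differentiable (respectively, $(k-s)$-times continuously differentiable) on $\Omega$, such that for every symmetric matrix $X$ with distinct eigenvalues and every orthogonal $V$ with $X=V(\mathrm{Diag}\,\lambda(X))V^T$, $$\nabla^s(f\circ\lambda)(X)=V\Big(\sum_{\sigma\in P^s}\mathrm{Diag}^{\sigma}\mathcal{A}_\sigma(\lambda(X))\Big)V^T .$$ Then for every symmetric matrix $X$ with distinct eigenvalues and every orthogonal $V$ with $X=V(\mathrm{Diag}\,\lambda(X))V^T$, $$\nabla^{s+1}(f\circ\lambda)(X)=V\Big(\sum_{\sigma\in P^s,\ l\in\{1,\dots,s+1\}}\mathrm{Diag}^{\sigma_{(l)}}\mathcal{A}_{\sigma_{(l)}}(\lambda(X))\Big)V^T,$$ where $\mathcal{A}_{\sigma_{(l)}}=(\mathcal{A}_\sigma)^{(l)}_{\mathrm{out}}$ for $l\in\{1,\dots,s\}$ and $\mathcal{A}_{\sigma_{(s+1)}}=\nabla\mathcal{A}_\sigma$.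
   Context: $S^n$ is the space of $n\times n$ real symmetric matrices and $M^n$ the space of all $n\times n$ real matrices, with $\langle X,Y\rangle=\mathrm{tr}(XY^T)$. For $X\in S^n$, $\lambda(X)=(\lambda_1(X),\dots,\lambda_n(X))$ is the vector of eigenvalues in nonincreasing order. $\mathrm{Diag}\,x$ is the diagonal matrix with diagonal $x$. $\Omega=\{x\in\mathbb{R}^n: x_i\ne x_j \text{ for all } i\neq j\}$. The function $f$ is not assumed symmetric; $f\circ\lambda$ is a function on $S^n$. $T^{k,n}$ is the space of $k$-tensors on $\mathbb{R}^n$ (maps $(\mathbb{R}^n)^k\to\mathbb{R}$ linear in each argument), with entries $T^{i_1\dots i_k}$. $P^s$ denotes the set of all permutations of $\{1,\dots,s\}$. For $T\in T^{k,n}$ and $\sigma\in P^k$, $\mathrm{Diag}^\sigma T$ is the $2k$-tensor on $\mathbb{R}^n$ whose entry with upper indices $i_1,\dots,i_k$ and lower indices $j_1,\dots,j_k$ equals $T^{i_1\dots i_k}$ if $i_r=j_{\sigma(r)}$ for all $r=1,\dots,k$, and $0$ otherwise. A $2k$-tensor $T$ on $\mathbb{R}^n$ is viewed as a $k$-tensor on $M^n$ by $T[H_1,\dots,H_k]=\sum_{p_1,q_1,\dots,p_k,q_k=1}^n T^{\substack{p_1\dots p_k\\ q_1\dots q_k}}H_1^{p_1q_1}\cdots H_k^{p_kq_k}$. The $s$-th derivative $\nabla^s(f\circ\lambda)(X)$ is an $s$-linear form on $S^n$; it is identified with $2s$-tensors through this formula with $H_1,\dots,H_s\in S^n$ (the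 last argument being the direction of the last differentiation). For an $m$-tensor $T$ and an orthogonal $V$, the conjugation $VTV^T$ is the $m$-tensor $(VTV^T)^{i_1\dots i_m}=\sum_{p_1,\dots,p_m=1}^n T^{p_1\dots p_m}V^{i_1p_1}\cdots V^{i_mp_m}$ (for $2k$-tensors it is applied to all $2k$ indices). For $\sigma\in P^s$, regarded also as a permutation of $\{1,\dots,s+1\}$ fixing $s+1$, and $l\in\{1,\dots,s+1\}$, put $\sigma_{(l)}=\sigma\tau_l$ where $\tau_l$ is the transposition $(l,s+1)$ ($\tau_{s+1}$ is the identity); thus $\sigma_{(l)}(l)=s+1$, $\sigma_{(l)}(s+1)=\sigma(l)$ for $l\le s$. Every element of $P^{s+1}$ is $\sigma_{(l)}$ for exactly one pair $(\sigma,l)$. For an $s$-tensor valued map $\mathcal{A}$ and $l\in\{1,\dots,s\}$, $\mathcal{A}^{(l)}_{\mathrm{out}}$ is the $(s+1)$-tensor valued map given at a point $\mu\in\Omega$ by $$\big(\mathcal{A}^{(l)}_{\mathrm{out}}(\mu)\big)^{i_1\dots i_si_{s+1}}=\begin{cases}0,& i_l=i_{s+1},\\ \dfrac{\mathcal{A}(\mu)^{i_1\dots i_{l-1}i_{s+1}i_{l+1}\dots i_s}-\mathcal{A}(\mu)^{i_1\dots i_{l-1}i_li_{l+1}\dots i_s}}{\mu_{i_{s+1}}-\mu_{i_l}},& i_l\neq i_{s+1}.\end{cases}$$ $\nabla\mathcal{A}$ is the $(s+1)$-tensor valued map with entries $(\nabla\mathcal{A}(\mu))^{i_1\dots i_si_{s+1}}=\frac{\partial}{\partial\mu_{i_{s+1}}}\mathcal{A}(\mu)^{i_1\dots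 i_s}$. *)

(* Defs.v *)
From HB Require Import structures.
From mathcomp Require Import all_boot all_order all_algebra.
From mathcomp Require Import fingroup perm sesquilinear.
From mathcomp Require Import all_classical all_reals all_analysis.

Set Implicit Arguments.
Unset Strict Implicit.
Unset Printing Implicit Defensive.

Import Order.TTheory GRing.Theory Num.Theory.
Import numFieldNormedType.Exports.

Local Open Scope classical_set_scope.
Local Open Scope ring_scope.

Lemma symmetricmxE (R : fieldType) n (A : 'M[R]_n) :
  (A \is symmetricmx) = (A == A^T).
Proof. by rewrite sesquiE expr0 scale1r map_mx_id. Qed.

Record symM (R : realType) (n : nat) := SymM {
  symval :> 'M[R]_n;
  _ : symval \is symmetricmx }.

Section SymM.
Variables (R : realType) (n : nat).

HB.instance Definition _ := [isSub for @symval R n].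
HB.instance Definition _ := [Choice of symM R n by <:].

Let sym_submod : submod_closed (symmetricmx : {pred 'M[R]_n}).
Proof.
split=> [|a A B]; rewrite !symmetricmxE ?trmx0 // => /eqP sA /eqP sB.
by rewrite linearP /= -sA -sB.
Qed.

HB.instance Definition _ :=
  GRing.SubChoice_isSubLmodule.Build R 'M[R]_n _ (symM R n) sym_submod.

Definition sym_norm (X : symM R n) : R := `|\val X|.

Let sym_normD (X Y : symM R n) : sym_norm (X + Y) <= sym_norm X + sym_norm Y.
Proof. exact: ler_normD. Qed.

Let sym_normZ (a : R) (X : symM R n) : sym_norm (a *: X) = `|a| * sym_norm X.
Proof. by rewrite /sym_norm linearZ normrZ. Qed.

Let sym_norm0 (X : symM R n) : sym_norm X = 0 -> X = 0.
Proof. by move=> /normr0_eq0 X0; apply: val_inj; rewrite X0 linear0. Qed.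

HB.instance Definition _ :=
  Lmodule_isNormed.Build R (symM R n) sym_normD sym_normZ sym_norm0.

End SymM.

Section Eigenvalues.
Variables (R : realType) (n : nat).

Definition is_ordered_spectrum (X : 'M[R]_n) (x : 'rV[R]_n) : Prop :=
  (forall i j : 'I_n, (i <= j)%N -> x 0 j <= x 0 i) /\
  char_poly X = \prod_(i < n) ('X - (x 0 i)%:P).

(* Exactly one vector satisfies [is_ordered_spectrum X] when [X] is symmetric,
   so the default value 0 of [xget] is never used. *)
Definition lambda (X : symM R n) : 'rV[R]_n :=
  xget 0 [set x | is_ordered_spectrum X x].

Definition Omega : set 'rV[R]_n := [set x | forall i j, i != j -> x 0 i != x 0 j].

Definition orthogonal_mx (V : 'M[R]_n) : Prop := V *m V^T = 1%:M.

Definition diagonalizes (V : 'M[R]_n) (X : symM R n) : Prop :=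
  orthogonal_mx V /\ \val X = V *m diag_mx (lambda X) *m V^T.

End Eigenvalues.

Section HigherDerivatives.
Variables (R : realType) (V : normedModType R) (F : V -> R).

(* The s-th derivative at X, as an s-linear form in the directions
   H 0, ..., H (s-1); the last one is that of the last differentiation. *)
Fixpoint nabla (s : nat) : V -> ('I_s -> V) -> R :=
  match s with
  | 0 => fun X _ => F X
  | s'.+1 => fun X H =>
      'd (fun Y : V => nabla Y (fun r : 'I_s' => H (lift ord_max r)) : R^o) X
        (H ord_max)
  end.

(* V is meant to be finite-dimensional (here 'rV_n or symM): a map into the
   s-linear forms on V is then differentiable (continuous) iff each of its
   evaluations is, which spares a norm on the space of forms. *)
Fixpoint ndifferentiable (k : nat) (X : V) : Prop :=
  match k with
  | 0 => True
  | k'.+1 =>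
      (\forall Y \near X, ndifferentiable k' Y) /\
      forall H : 'I_k' -> V,
        differentiable (fun Y : V => nabla Y H : R^o) X
  end.

Definition ncontinuously_differentiable (k : nat) (X : V) : Prop :=
  (\forall Y \near X, ndifferentiable k Y) /\
  forall H : 'I_k -> V, {for X, continuous (fun Y : V => nabla Y H)}.

End HigherDerivatives.

(* The two parallel ("respectively") readings of the hypotheses. *)
Variant regularity := Differentiable | ContinuouslyDifferentiable.

Definition times_differentiable (c : regularity) (R : realType)
    (V : normedModType R) (k : nat) (F : V -> R) (X : V) : Prop :=
  match c with
  | Differentiable => ndifferentiable F k X
  | ContinuouslyDifferentiable => ncontinuously_differentiable F k X
  end.

(* k-tensors on R^n, given by their entries. *)
Notation tensor R k n := {ffun {ffun 'I_k -> 'I_n} -> R}.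

Section Tensors.
Variables (R : realType) (n : nat).

(* The upper indices of a 2k-tensor are its first k ones, the lower indices
   its last k ones. *)
Definition upper k (i : {ffun 'I_(k + k) -> 'I_n}) : {ffun 'I_k -> 'I_n} :=
  [ffun r => i (lshift k r)].
Definition lower k (i : {ffun 'I_(k + k) -> 'I_n}) : {ffun 'I_k -> 'I_n} :=
  [ffun r => i (rshift k r)].

Definition Diag_perm k (sigma : 'S_k) (T : tensor R k n) : tensor R (k + k) n :=
  [ffun i => if [forall r, upper i r == lower i (sigma r)] then T (upper i)
             else 0].

Definition tensor_form k (T : tensor R (k + k) n) (H : 'I_k -> 'M[R]_n) : R :=
  \sum_i T i * \prod_(r < k) H r (upper i r) (lower i r).

Definition tensor_conj m (V : 'M[R]_n) (T : tensor R m n) : tensor R m n :=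
  [ffun i : {ffun 'I_m -> 'I_n} =>
    \sum_(p : {ffun 'I_m -> 'I_n}) T p * \prod_(r < m) V (i r) (p r)].

(* sigma_(l) = sigma o tau_l; note that (s * t)%g x = t (s x). *)
Definition perm_ext s (sigma : 'S_s) (l : 'I_s.+1) : 'S_s.+1 :=
  (tperm l ord_max * lift_perm ord_max ord_max sigma)%g.

Definition init_index s (i : {ffun 'I_s.+1 -> 'I_n}) : {ffun 'I_s -> 'I_n} :=
  [ffun r => i (lift ord_max r)].

Definition tensor_out s (A : 'rV[R]_n -> tensor R s n) (l : 'I_s)
    (mu : 'rV[R]_n) : tensor R s.+1 n :=
  [ffun i : {ffun 'I_s.+1 -> 'I_n} =>
    let il := i (lift ord_max l) in
    let iS := i ord_max in
    if il == iS then 0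
    else (A mu [ffun r => if r == l then iS else init_index i r]
          - A mu (init_index i)) / (mu 0 iS - mu 0 il)].

Definition tensor_grad s (A : 'rV[R]_n -> tensor R s n)
    (mu : 'rV[R]_n) : tensor R s.+1 n :=
  [ffun i : {ffun 'I_s.+1 -> 'I_n} =>
    'D_(delta_mx 0 (i ord_max))
      (fun x : 'rV[R]_n => A x (init_index i) : R^o) mu].

(* A_(sigma_(l)) obtained from A = A_sigma *)
Definition tensor_ext s (A : 'rV[R]_n -> tensor R s n) (l : 'I_s.+1) :
    'rV[R]_n -> tensor R s.+1 n :=
  if unlift ord_max l is Some l' then tensor_out A l' else tensor_grad A.

Definition times_differentiable_tensor (c : regularity) s (k : nat)
    (A : 'rV[R]_n -> tensor R s n) (mu : 'rV[R]_n) : Prop :=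
  forall i, times_differentiable c k (fun x => A x i) mu.

(* nabla^s F (X), an s-linear form on S^n, is represented by the tensor T. *)
Definition nabla_is_tensor (F : symM R n -> R) s (X : symM R n)
    (T : tensor R (s + s) n) : Prop :=
  forall H : 'I_s -> symM R n, nabla F X H = tensor_form T (fun r => \val (H r)).

End Tensors.

(* Main.v *)
Require Import Defs.
From HB Require Import structures.
From mathcomp Require Import all_boot all_order all_algebra.
From mathcomp Require Import fingroup perm sesquilinear.
From mathcomp Require Import all_classical all_reals all_analysis.

Set Implicit Arguments.
Unset Strict Implicit.
Unset Printing Implicit Defensive.

Import Order.TTheory GRing.Theory Num.Theory.
Import numFieldNormedType.Exports.

Local Open Scope classical_set_scope.
Local Open Scope ring_scope.

(** Let U be the set of symmetric matrices with distinct eigenvalues.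

    Regularity of f \o lambda. On U the function f \o lambda has the regularity
    of f because lambda is smooth there. Intermediate values of the
    characteristic polynomial show that U is open and that lambda is continuous
    on U ([near_lambda]). For Y close to X in U and x = lambda X,
      x_i - lambda_i(Y) = det (x_i - Y) / prod_(j != i) (x_i - lambda_j(Y)),
    a differentiable function vanishing at X divided by a continuous one, so
    lambda_i is differentiable, and its derivative at X is a rational function
    of lambda X and of the entries of X ([is_diff_lambda]). Hence as many
    derivatives as desired follow by induction ([smooth_on_lambda]), and the
    chain rule concludes ([smooth_on_comp_lambda]).

    Formula for the derivative of order s+1. An orthogonal V diagonalizing X
    extends to an orthogonal W(Y) diagonalizing Y for Y near X, differentiable
    at X: apply to the i-th column of V the product of the Y - lambda_j(Y) for
    j != i, and normalise ([mx_diff_eigenbasis], [near_eigenbasis]). By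
    hypothesis the derivative of order s at Y is then a sum over sigma of the
    forms
      sum_u A_sigma(lambda Y)_u prod_r (W^T H_r W)_(u_r, u_(sigma^-1 r)).
    Let H be the new direction and D = V^T H V. Then V^T W' is the skew matrix
    K with off-diagonal entries D_ab / (x_b - x_a), and lambda_a' = D_aa
    ([derivative_eigenbasis]). Differentiating A_sigma(lambda Y) gives the term
    of the gradient. Differentiating the factor W^T H_r W =: B_r gives the
    commutator B_r K - K B_r. Collecting, for each l, the two places where the
    index u_l occurs, and exchanging u_l with the summation index of the matrix
    product, turns the entries of K into the divided differences that define
    A_out^(l) ([sum_diag_form_ext]). *)

(** * Differentials at a point *)
Section PointwiseDifferential.
Variables (R : realType) (V W : normedModType R).

(** An epsilon form of differentiability with an explicit candidate L, which
    spares exhibiting the remainder as a little-o. *)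
Lemma is_diff_estimate (F : V -> W) (x : V) (L : {linear V -> W}) :
  continuous L ->
  (forall e, 0 < e ->
    \forall h \near (0 : V), `|F (h + x) - F x - L h| <= e * `|h|) ->
  is_diff x F L.
Proof.
move=> cL est.
have FE : F \o shift x = cst (F x) + L +o_ (0 : V) id.
  apply/eqaddoP => e e0; near=> h.
  rewrite /= !fctE /= /cst opprD addrA; near: h; exact: est.
have dF := diff_unique cL FE.
apply: DiffDef; last by rewrite dF.
by apply/diff_locallyP; rewrite dF.
Unshelve. all: by end_near. Qed.

Lemma differentiable_estimate (F : V -> W) (x : V) (e : R) :
  differentiable F x -> 0 < e ->
  \forall h \near (0 : V), `|F (h + x) - F x - 'd F x h| <= e * `|h|.
Proof.
move=> /diff_locallyP[_ /eqaddoP/(_ e)] + e0 => /(_ e0); apply: filterS => h.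
by rewrite /= !fctE /= /cst opprD addrA.
Qed.

(** Differentials depend on germs only: the spectral formulas below hold just
    near a given matrix. *)
Lemma near_is_diff (F G dG : V -> W) (x : V) :
  (\forall y \near x, F y = G y) -> is_diff x G dG -> is_diff x F dG.
Proof.
move=> FG [dfG <-]; apply: is_diff_estimate; first exact: diff_continuous.
move=> e e0; have Fx : F x = G x by exact: nbhs_singleton FG.
have := differentiable_estimate dfG e0.
move: FG => /nbhs0P FG est; near=> h.
have -> : F (h + x) = G (h + x) by rewrite addrC; near: h.
by rewrite Fx; near: h.
Unshelve. all: by end_near. Qed.

Lemma is_diff_fsum (I : Type) (r : seq I) (P : pred I) (F dF : I -> V -> W) x :
  (forall i, P i -> is_diff x (F i) (dF i)) ->
  is_diff x (fun y => \sum_(i <- r | P i) F i y)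
    (fun h => \sum_(i <- r | P i) dF i h).
Proof.
move=> dFi; elim: r => [|i r IHr].
  rewrite (_ : (fun y => _) = cst 0); last by apply/funext=> y; rewrite big_nil.
  apply: is_diff_eq (is_diff_cst _ _) _.
  by apply/funext=> y; rewrite big_nil.
rewrite (_ : (fun y => _) = fun y => if P i then
    F i y + \sum_(j <- r | P j) F j y else \sum_(j <- r | P j) F j y); last first.
  by apply/funext=> y; rewrite big_cons.
rewrite (_ : (fun y => \sum_(j <- i :: r | _) _) = fun y => if P i then
    dF i y + \sum_(j <- r | P j) dF j y else \sum_(j <- r | P j) dF j y);
    last first.
  by apply/funext=> y; rewrite big_cons.
case: (boolP (P i)) => // Pi; exact: is_diffD (dFi _ Pi) IHr.
Qed.

End PointwiseDifferential.

Section RealValued.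
Variables (R : realType) (V : normedModType R).
Implicit Types (F G : V -> R) (x h : V).

Lemma continuous_at_dist F x :
  (forall e, 0 < e -> \forall y \near x, `|F x - F y| < e) ->
  {for x, continuous F}.
Proof. by move=> Fx; apply/cvgrPdist_lt. Qed.

Lemma continuous_fprod (I : Type) (r : seq I) (P : pred I) (F : I -> V -> R) x :
  (forall i, P i -> {for x, continuous (F i)}) ->
  {for x, continuous (fun y => \prod_(i <- r | P i) F i y)}.
Proof. by move=> Fx; apply: cvg_big => //; exact: mul_continuous. Qed.

(** When F vanishes at x, the increment of F * G is F (x + h) * G (x + h), in
    which G (x + h) may be replaced by G x up to o(h); hence mere continuity of
    the second factor suffices. This is how a continuous eigenvalue is shown to
    be differentiable. *)
Lemma is_diff_mul_vanishing F G dF x :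
  is_diff x F dF -> F x = 0 -> {for x, continuous G} ->
  is_diff x (fun y => F y * G y) (fun h => dF h * G x).
Proof.
move=> [dfF <-] F0 cG; have cdF : continuous ('d F x) by exact: diff_continuous.
have -> : (fun h => 'd F x h * G x) = (G x \*: 'd F x : V -> R).
  by apply/funext => h /=; rewrite mulrC.
have cL : continuous ((G x \*: 'd F x : {linear V -> R^o})).
  by move=> y; apply: cvgZl_tmp; exact: cdF.
apply: (is_diff_estimate (L := (G x \*: 'd F x : {linear V -> R^o}))) => // e e0.
have [C C0 dFC] := linear_lipschitz cdF.
set M := `|G x| + 1.
have M0 : 0 < M by rewrite ltr_wpDl.
have e1 : 0 < e / 2 / M by rewrite !divr_gt0.
have e2 : 0 < e / 2 / C by rewrite !divr_gt0.
have est := differentiable_estimate dfF e1.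
have cG0 : \forall h \near (0 : V), `|G x - G (h + x)| < Num.min (e / 2 / C) 1.
  have e3 : 0 < Num.min (e / 2 / C) 1 by rewrite lt_min e2 ltr01.
  have /cvgrPdist_lt/(_ _ e3)/nbhs0P := cG.
  by apply: filterS => h; rewrite [h + x]addrC.
near=> h.
rewrite F0 mul0r subr0 /=.
have Gh : `|G x - G (h + x)| < Num.min (e / 2 / C) 1 by near: h.
have Fh : `|F (h + x) - F x - 'd F x h| <= e / 2 / M * `|h| by near: h.
move: Gh; rewrite lt_min => /andP[Gh1 Gh2].
have GM : `|G (h + x)| <= M.
  rewrite -[G (h + x)](subKr (G x)) (le_trans (ler_normB _ _)) // lerD2l.
  exact: ltW.
have -> : F (h + x) * G (h + x) - G x *: ('d F x h : R^o) =
    (F (h + x) - F x - 'd F x h) * G (h + x) - 'd F x h * (G x - G (h + x)).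
  by rewrite F0 subr0 /GRing.scale /= !mulrBl !mulrBr (mulrC (G x)) opprB addrA subrK.
rewrite (le_trans (ler_normB _ _)) // !normrM.
rewrite [e]splitr mulrDl lerD //.
  have -> : e / 2 * `|h| = e / 2 / M * `|h| * M.
    by rewrite [RHS]mulrAC divfK // gt_eqF.
  by rewrite ler_pM.
have -> : e / 2 * `|h| = C * `|h| * (e / 2 / C).
  by rewrite [RHS]mulrC mulrA divfK // gt_eqF.
by rewrite ler_pM // ltW.
Unshelve. all: by end_near. Qed.

Lemma is_diff_mul F G dF dG x : is_diff x F dF -> is_diff x G dG ->
  is_diff x (fun y => F y * G y) (fun h => F x * dG h + G x * dF h).
Proof. by move=> hF hG; exact: is_diffM. Qed.

Lemma is_diff_fprod (I : eqType) (r : seq I) (F dF : I -> V -> R) x :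
  uniq r -> (forall i, is_diff x (F i) (dF i)) ->
  is_diff x (fun y => \prod_(i <- r) F i y)
    (fun h => \sum_(i <- r) dF i h * \prod_(j <- r | j != i) F j x).
Proof.
move=> + dFi; elim: r => [_|i r IHr /= /andP[ir ur]].
  rewrite (_ : (fun y => _) = cst 1); last by apply/funext=> y; rewrite big_nil.
  apply: is_diff_eq (is_diff_cst _ _) _.
  by apply/funext=> y; rewrite big_nil.
rewrite (_ : (fun y => _) = fun y => F i y * \prod_(j <- r) F j y); last first.
  by apply/funext=> y; rewrite big_cons.
apply: is_diff_eq (is_diff_mul (dFi i) (IHr ur)) _.
apply/funext => h; rewrite big_cons addrC; congr (_ + _).
  rewrite big_cons eqxx /= mulrC; congr (_ * _).
  rewrite [RHS]big_seq_cond [LHS]big_seq; apply: eq_bigl => j.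
  by case: (boolP (j \in r)) => //= jr; apply/esym; apply: contraNneq ir => <-.
rewrite mulr_sumr [LHS]big_seq [RHS]big_seq; apply: eq_bigr => j jr.
rewrite big_cons ifT; first by rewrite mulrCA.
by apply: contraNneq ir => ->.
Qed.

Lemma is_diff_scalel (W : normedModType R) F dF (w : W) x :
  is_diff x F dF -> is_diff x (fun y => F y *: w) (fun h => dF h *: w).
Proof.
move=> [Fd dFE]; apply: DiffDef; first exact: differentiableZl.
by rewrite diffZl // dFE.
Qed.

End RealValued.

(** * Iterated derivatives, peeled from the inside *)

(** The scalars are R itself here, while the derivatives of the statement take
    values in its regular module R^o; both carry the same norm. *)
Definition dird (R : realType) (V : normedModType R) (F : V -> R) (h x : V) : R :=
  'd F x h.

Section DerivativeFromInside.
Variables (R : realType) (V : normedModType R).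
Implicit Types (F G : V -> R) (k : nat).

(** [nabla] differentiates the previous derivative, which leaves the function
    buried; peeling the first direction instead makes induction on the order
    apply to the function dird F h. *)
Lemma nablaS F k x (H : 'I_k.+1 -> V) :
  nabla F x H =
  nabla (dird F (H ord0)) x (fun r => H (lift ord0 r)).
Proof.
elim: k x H => [|k IHk] x H.
  by rewrite /= (_ : ord_max = ord0) //; apply: val_inj.
rewrite -[LHS]/('d (fun Y : V => nabla F (s := k.+1) Y
  (fun r => H (lift ord_max r)) : R^o) x (H ord_max)).
rewrite (_ : (fun Y => _) = (fun Y : V => nabla (dird F (H ord0))
    Y (fun r => H (lift ord0 (lift ord_max r))) : R^o)).
  by rewrite /= (_ : lift ord0 ord_max = ord_max) //; apply: val_inj.
apply/funext => Y; apply: etrans (IHk _ _) _.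
rewrite (_ : lift ord_max ord0 = ord0); last exact: val_inj.
congr nabla; apply/funext => r; congr H; apply: val_inj => /=.
by rewrite /bump !add1n /= ltnS; case: ltnP => //; rewrite add1n.
Qed.

Definition consdir k (h : V) (H : 'I_k -> V) : 'I_k.+1 -> V :=
  fun r => if unlift ord0 r is Some r' then H r' else h.

Lemma nabla_consdir F k h (H : 'I_k -> V) x :
  nabla F x (consdir h H) = nabla (dird F h) x H.
Proof.
rewrite nablaS /consdir unlift_none; congr nabla.
by apply/funext => r; rewrite liftK.
Qed.

Lemma ndifferentiable_nbhs F k x :
  ndifferentiable F k.+1 x -> ndifferentiable F k x.
Proof. by case=> /nbhs_singleton. Qed.

End DerivativeFromInside.

Section SmoothOn.
Variables (R : realType) (c : regularity).

Definition smooth_on (V : normedModType R) (U : set V) k (F : V -> R) : Prop :=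
  forall x, U x -> times_differentiable c k F x.

Section Recursion.
Variables (V : normedModType R) (U : set V).
Hypothesis openU : open U.
Implicit Types (F G : V -> R).

Let ndiff_on k F := forall x, U x -> ndifferentiable F k x.

Let ndiff_onS k F : ndiff_on k.+1 F <->
  (forall x, U x -> differentiable F x) /\
  (forall h, ndiff_on k (dird F h)).
Proof.
have lower F' m : ndiff_on m.+1 F' -> ndiff_on m F'.
  by move=> F'm x Ux; apply: ndifferentiable_nbhs; exact: F'm.
have nearU (P : V -> Prop) x : (forall y, U y -> P y) -> U x ->
    \forall y \near x, P y.
  by move=> UP Ux; apply: filterS UP _; exact: open_nbhs_nbhs.
elim: k F => [|k IHk] F.
  split=> [Fd|[Fd _] x Ux]; first split=> // x Ux.
    by have [_] := Fd x Ux; apply; case.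
  by split=> [|H]; [exact: filterE|exact: Fd].
split=> [Fd|[Fd dFd] x Ux].
  have [Fd1 dFd] := (IHk F).1 (lower _ _ Fd).
  split=> // h x Ux; split.
    by apply: nearU => //; exact: dFd.
  move=> H; have [_] := Fd x Ux => /(_ (consdir h H)).
  by under eq_fun do rewrite nabla_consdir.
split.
  apply: nearU => //; apply/IHk; split=> // h; apply: lower; exact: dFd.
move=> H; under eq_fun do rewrite nablaS.
by have [_] := dFd (H ord0) x Ux; apply.
Qed.

(** This recursion drives every induction on the order below. It needs an
    open set: at a single point the derivative of order k exists only if the
    lower ones exist in a neighbourhood. *)
Lemma smooth_onS k F : smooth_on U k.+1 F <->
  (forall x, U x -> differentiable F x) /\
  (forall h, smooth_on U k (dird F h)).
Proof.
rewrite /smooth_on; case: c => /=; first exact: ndiff_onS.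
have contE m G : (forall x, U x -> ncontinuously_differentiable G m x) <->
    ndiff_on m G /\
    forall H x, U x -> {for x, continuous (fun Y => nabla G (s := m) Y H)}.
  split=> [Gc|[Gd Gc] x Ux].
    split=> [x Ux|H x Ux]; first by have [/nbhs_singleton] := Gc x Ux.
    by have [_] := Gc x Ux; apply.
  split=> [|H]; last exact: Gc.
  by apply: filterS Gd _; exact: open_nbhs_nbhs.
rewrite contE ndiff_onS; split=> [[[Fd dFd] Fc]|[Fd dFc]].
  split=> // h; apply/contE; split=> // H x Ux.
  have := Fc (consdir h H) x Ux.
  suff -> : (fun Y => nabla F Y (consdir h H)) =
    fun Y => nabla (dird F h) Y H by [].
  by apply/funext => Y; exact: nabla_consdir.
split; first by split=> // h; have /contE[] := dFc h.
move=> H x Ux.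
have -> : (fun Y => nabla F Y H) = fun Y => nabla (dird F (H ord0)) Y (fun r => H (lift ord0 r)).
  by apply/funext => Y; exact: nablaS.
by have /contE[_ hc] := dFc (H ord0); exact: hc.
Qed.

End Recursion.
End SmoothOn.

(** * Operations preserving differentiability of order k *)
Section SmoothOps.
Variables (R : realType) (c : regularity) (V : normedModType R) (U : set V).
Hypothesis openU : open U.
Implicit Types (F G : V -> R).

Lemma smooth_on0P F : smooth_on c U 0 F <->
  (c = ContinuouslyDifferentiable -> forall x, U x -> {for x, continuous F}).
Proof.
rewrite /smooth_on; case: c => /=; split=> //; last first.
  by move=> /(_ erefl) Fc x Ux; split; [exact: filterE|move=> H; exact: Fc].
by move=> Fc _ x Ux; have [_] := Fc x Ux; apply; case.
Qed.

#[local] Opaque smooth_on.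

Lemma eq_smooth_on k F G : (forall x, U x -> F x = G x) ->
  smooth_on c U k G -> smooth_on c U k F.
Proof.
have nearU F' G' x : (forall x, U x -> F' x = G' x :> R) -> U x ->
    \forall y \near x, F' y = G' y.
  by move=> FG Ux; apply: filterS FG _; exact: open_nbhs_nbhs.
elim: k F G => [|k IHk] F G FG.
  move=> /smooth_on0P Gc; apply/smooth_on0P => cE x Ux.
  rewrite /prop_for /continuous_at (FG _ Ux).
  apply: cvg_trans (Gc cE x Ux); apply: near_eq_cvg; apply: nearU => // y Uy.
  by rewrite FG.
move=> /(smooth_onS c openU)[Gd dG].
have dFG x : U x -> is_diff x F ('d G x).
  move=> Ux; apply: (@near_is_diff _ _ _ F G); first exact: nearU.
  by split=> //; exact: Gd.
apply/(smooth_onS c openU); split=> [x Ux|h]; first by have [] := dFG x Ux.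
apply: IHk (dG h) => x Ux.
by rewrite /dird; have [_ ->] := dFG x Ux.
Qed.

Lemma is_diff_smooth_on k F (G : V -> V -> R) :
  (forall x, U x -> is_diff x F (fun h => G h x)) ->
  (forall h, smooth_on c U k (G h)) -> smooth_on c U k.+1 F.
Proof.
move=> dF Gk; apply/(smooth_onS c openU); split=> [x Ux|h].
  by have [] := dF x Ux.
apply: eq_smooth_on (Gk h) => x Ux.
by rewrite /dird; have [_ ->] := dF x Ux.
Qed.

Lemma smooth_onW k F : smooth_on c U k.+1 F -> smooth_on c U k F.
Proof.
elim: k F => [|k IHk] F /(smooth_onS c openU)[Fd dF].
  apply/smooth_on0P => _ x Ux.
  exact/differentiable_continuous/Fd.
by apply/(smooth_onS c openU); split=> // h; exact: IHk.
Qed.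

Lemma smooth_on_diff_at k F : smooth_on c U k.+1 F ->
  forall x, U x -> is_diff x F ('d F x).
Proof. by move=> /(smooth_onS c openU)[Fd _] x Ux; split=> //; exact: Fd. Qed.

Lemma smooth_on_d k F h :
  smooth_on c U k.+1 F -> smooth_on c U k (dird F h).
Proof. by move=> /(smooth_onS c openU)[_]; apply. Qed.

Lemma smooth_on_cst k (a : R) : smooth_on c U k (fun=> a).
Proof.
elim: k a => [|k IHk] a; first by apply/smooth_on0P => _ x _; exact: cvg_cst.
by apply: (is_diff_smooth_on (G := fun _ _ => 0)) => // x _; exact: is_diff_cst.
Qed.

Lemma smooth_onD k F G : smooth_on c U k F -> smooth_on c U k G ->
  smooth_on c U k (fun x => F x + G x).
Proof.
elim: k F G => [|k IHk] F G Fs Gs.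
  apply/smooth_on0P => cE x Ux; apply: cvgD.
    by move/smooth_on0P: Fs => /(_ cE) /(_ _ Ux).
  by move/smooth_on0P: Gs => /(_ cE) /(_ _ Ux).
apply: (is_diff_smooth_on
  (G := fun h x => dird F h x + dird G h x)) => [x Ux|h].
  exact: is_diffD (smooth_on_diff_at Fs Ux) (smooth_on_diff_at Gs Ux).
by apply: IHk; apply: smooth_on_d.
Qed.

Lemma smooth_onM k F G : smooth_on c U k F -> smooth_on c U k G ->
  smooth_on c U k (fun x => F x * G x).
Proof.
elim: k F G => [|k IHk] F G Fs Gs.
  apply/smooth_on0P => cE x Ux; apply: cvgM.
    by move/smooth_on0P: Fs => /(_ cE) /(_ _ Ux).
  by move/smooth_on0P: Gs => /(_ cE) /(_ _ Ux).
apply: (is_diff_smooth_on (G := fun h x =>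
    F x * dird G h x + G x * dird F h x)) => [x Ux|h].
  exact: is_diff_mul (smooth_on_diff_at Fs Ux) (smooth_on_diff_at Gs Ux).
by apply: smooth_onD; apply: IHk (smooth_onW _) (smooth_on_d h _).
Qed.

Lemma smooth_onB k F G : smooth_on c U k F -> smooth_on c U k G ->
  smooth_on c U k (fun x => F x - G x).
Proof.
move=> Fs Gs; apply: (eq_smooth_on (G := fun x => F x + (-1) * G x)).
  by move=> x _; rewrite mulN1r.
by apply: smooth_onD => //; apply: smooth_onM => //; exact: smooth_on_cst.
Qed.

Lemma smooth_on_sum k (I : Type) (r : seq I) (P : pred I) (F : I -> V -> R) :
  (forall i, P i -> smooth_on c U k (F i)) ->
  smooth_on c U k (fun x => \sum_(i <- r | P i) F i x).
Proof.
move=> Fs; elim: r => [|i r IHr].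
  by apply: (eq_smooth_on (G := fun=> 0)) => [x _|];
    [rewrite big_nil|exact: smooth_on_cst].
apply: (eq_smooth_on (G := fun x => if P i then F i x + \sum_(j <- r | P j) F j x
  else \sum_(j <- r | P j) F j x)) => [x _|]; first by rewrite big_cons.
by case: (boolP (P i)) => // Pi; apply: smooth_onD => //; exact: Fs.
Qed.

Lemma smooth_on_prod k (I : Type) (r : seq I) (P : pred I) (F : I -> V -> R) :
  (forall i, P i -> smooth_on c U k (F i)) ->
  smooth_on c U k (fun x => \prod_(i <- r | P i) F i x).
Proof.
move=> Fs; elim: r => [|i r IHr].
  by apply: (eq_smooth_on (G := fun=> 1)) => [x _|];
    [rewrite big_nil|exact: smooth_on_cst].
apply: (eq_smooth_on (G := fun x => if P i then F i x * \prod_(j <- r | P j) F j x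
  else \prod_(j <- r | P j) F j x)) => [x _|]; first by rewrite big_cons.
by case: (boolP (P i)) => // Pi; apply: smooth_onM => //; exact: Fs.
Qed.

Lemma smooth_onV k F : (forall x, U x -> F x != 0) -> smooth_on c U k F ->
  smooth_on c U k (fun x => (F x)^-1).
Proof.
move=> F0; elim: k => [|k IHk] Fs.
  apply/smooth_on0P => cE x Ux; apply: cvgV; first exact: F0.
  by move/smooth_on0P: Fs => /(_ cE) /(_ _ Ux).
apply: (is_diff_smooth_on (G := fun h x =>
    (-1) * ((F x)^-1 * (F x)^-1) * dird F h x)) => [x Ux|h].
  have [Fd _] := smooth_on_diff_at Fs Ux; have Fx := F0 x Ux.
  apply: DiffDef; first exact: differentiableV.
  rewrite (_ : -1 * _ = - (F x) ^- 2); last by rewrite mulN1r expr2 invfM.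
  exact: diffV.
apply: smooth_onM; last exact: smooth_on_d.
apply: smooth_onM; first exact: smooth_on_cst.
by have := IHk (smooth_onW Fs) => ?; exact: smooth_onM.
Qed.

Lemma smooth_on_linear k (L : {linear V -> R}) :
  continuous L -> smooth_on c U k L.
Proof.
move=> cL; case: k => [|k]; first by apply/smooth_on0P => _ x _; exact: cL.
apply: (is_diff_smooth_on (G := fun h _ => L h)) => [x _|h].
  by split; [exact: linear_differentiable|rewrite diff_lin].
exact: smooth_on_cst.
Qed.

End SmoothOps.

#[local] Opaque smooth_on.

Section ChainRule.
Variables (R : realType) (V : normedModType R) (m : nat).
Implicit Types (g : V -> 'rV[R]_m) (f : 'rV[R]_m -> R).

(** A row is the combination of basis rows with its entries as coefficients,
    so continuity, like differentiability below, is read on the entries. *)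
Lemma continuous_rowP g (x : V) :
  (forall j, {for x, continuous (fun y => g y 0 j)}) -> {for x, continuous g}.
Proof.
move=> gc.
rewrite (_ : g = fun y => \sum_j g y 0 j *: delta_mx 0 j); last first.
  by apply/funext => y; exact: row_sum_delta.
apply: cvg_big => [|j _]; last by apply: cvgZr_tmp; exact: gc.
exact: add_continuous.
Qed.

Lemma is_diff_row g dg (x : V) : (forall j, is_diff x (fun y => g y 0 j) (dg j)) ->
  is_diff x g (fun h => \row_j dg j h).
Proof.
move=> dgj.
rewrite (_ : g = fun y => \sum_j g y 0 j *: delta_mx 0 j); last first.
  by apply/funext => y; exact: row_sum_delta.
apply: is_diff_eq.
  apply: (is_diff_fsum _ (dF := fun j h => dg j h *: delta_mx 0 j)) => j _.
  exact: is_diff_scalel.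
apply/funext => h; rewrite [RHS]row_sum_delta.
by apply: eq_bigr => j _; rewrite mxE.
Qed.

Lemma is_diff_comp_row f g dg (x : V) :
  differentiable f (g x) ->
  (forall j, is_diff x (fun y => g y 0 j) (dg j)) ->
  is_diff x (f \o g)
    (fun h => \sum_j dg j h * 'd f (g x) (delta_mx 0 j)).
Proof.
move=> fd /is_diff_row gd.
have fd' : is_diff (g x) f ('d f (g x)) by split.
apply: is_diff_eq (is_diff_comp gd fd') _.
apply/funext => h /=; rewrite [X in 'd _ _ X]row_sum_delta linear_sum.
by apply: eq_bigr => j _; rewrite linearZ mxE.
Qed.

(** Induction on k: the derivative of f \o g in direction h is the sum over j
    of (D_h g_j) * (D_(e_j) f \o g), a sum of products of functions of order
    k - 1. *)
Lemma smooth_on_comp c (U : set V) k f g : open U ->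
  smooth_on c setT k f -> (forall j, smooth_on c U k (fun x => g x 0 j)) ->
  smooth_on c U k (f \o g).
Proof.
move=> openU; elim: k f => [|k IHk] f fs gs.
  apply/smooth_on0P => cE x Ux; apply: continuous_comp.
    apply: continuous_rowP => j.
    by move/smooth_on0P: (gs j) => /(_ cE) /(_ _ Ux).
  by move/smooth_on0P: fs => /(_ cE) /(_ _ I).
apply: (is_diff_smooth_on openU (G := fun h x => \sum_j
    dird (fun x => g x 0 j) h x * dird f (delta_mx 0 j) (g x))).
  move=> x Ux; apply: is_diff_comp_row.
    by have [] := smooth_on_diff_at openT fs (x := g x) I.
  by move=> j; exact: smooth_on_diff_at (gs j) _ Ux.
move=> h; apply: smooth_on_sum => // j _; apply: smooth_onM => //.
  by apply: smooth_on_d => //; exact: gs.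
apply: (IHk (dird f (delta_mx 0 j))).
  exact: smooth_on_d openT _ _ _ fs.
by move=> i; apply: smooth_onW.
Qed.

End ChainRule.

(** * Symmetric matrices and their ordered spectrum *)
Section Entries.
Variables (R : realType) (n : nat).

Definition entry (i j : 'I_n) (X : symM R n) : R := \val X i j.

Fact entry_is_linear i j : linear (entry i j).
Proof. by move=> a X Y; rewrite /entry linearP !mxE. Qed.
HB.instance Definition _ i j := GRing.isLinear.Build R (symM R n) R _ (entry i j)
  (entry_is_linear i j).

Lemma le_entry_norm i j (X : symM R n) : `|entry i j X| <= `|X|.
Proof.
rewrite (_ : `|X| = mx_norm (\val X)) // mx_normrE.
exact: (le_bigmax _ (fun ij : 'I_n * 'I_n => `|\val X ij.1 ij.2|) (i, j)).
Qed.

Lemma entry_continuous i j : continuous (entry i j).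
Proof.
apply/linear_bounded_continuous/linear_boundedP; near=> r => X.
by rewrite (le_trans (le_entry_norm _ _ _)) // ler_peMl.
Unshelve. all: by end_near. Qed.

Lemma is_diff_entry i j X : is_diff X (entry i j) (entry i j).
Proof.
split; first exact/linear_differentiable/entry_continuous.
exact/diff_lin/entry_continuous.
Qed.

Lemma smooth_on_entry c k U i j : open U -> smooth_on c U k (entry i j).
Proof. by move=> openU; apply: smooth_on_linear => //; exact: entry_continuous. Qed.

End Entries.

Section OrderedSpectrum.
Variables (R : realType) (n : nat).
Implicit Types (X Y : 'M[R]_n) (x y : 'rV[R]_n).

Lemma horner_char_poly X (t : R) : (char_poly X).[t] = \det (t%:M - X).
Proof.
rewrite -[LHS]/(horner_eval t (char_poly X)) -det_map_mx; congr (\det _).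
apply/matrixP => i j; rewrite !mxE /= /horner_eval !hornerE.
by rewrite hornerMn hornerX.
Qed.

Lemma is_ordered_spectrum_uniq X x y :
  is_ordered_spectrum X x -> is_ordered_spectrum X y -> x = y.
Proof.
move=> [xs xE] [ys yE].
have sorted_row (z : 'rV[R]_n) : (forall i j : 'I_n, (i <= j)%N -> z 0 j <= z 0 i) ->
    sorted >=%R [seq z 0 i | i <- enum 'I_n].
  move=> zs; rewrite sorted_map; have := iota_sorted 0 n.
  rewrite -val_enum_ord sorted_map.
  apply: sub_sorted => i j; exact: zs.
have : perm_eq [seq x 0 i | i <- enum 'I_n] [seq y 0 i | i <- enum 'I_n].
  by apply: prod_XsubC_eq; rewrite [LHS]big_map [RHS]big_map enumT -xE -yE.
move=> /(sorted_eq ge_trans ge_anti (sorted_row _ xs) (sorted_row _ ys)) xy.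
apply/rowP => i; have /eq_in_map := xy; apply; exact: mem_enum.
Qed.

(** Without any ordered spectrum lambda X would be the default 0, which has
    repeated entries as soon as n > 1; for n <= 1 a spectrum is exhibited. *)
Lemma lambda_spectrum (X : symM R n) :
  Omega (lambda X) -> is_ordered_spectrum (\val X) (lambda X).
Proof.
rewrite /lambda => OX; case: xgetP OX => [x -> //|noX] O0; exfalso.
case: n X noX O0 => [|[|m]] X noX O0.
- by apply: (noX 0); split=> [[]//|]; rewrite big_ord0 /char_poly det_mx00.
- apply: (noX (\val X)); split=> [i j _|]; first by rewrite (ord1 i) (ord1 j).
  by rewrite big_ord1 /char_poly det_mx11 !mxE eqxx.
- by have := O0 ord0 ord_max isT; rewrite !mxE eqxx.
Qed.

Lemma lambda_eq (X : symM R n) x : is_ordered_spectrum (\val X) x -> lambda X = x.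
Proof.
move=> xX; apply: (@is_ordered_spectrum_uniq (\val X)) => //.
by apply: (@xgetPex _ 0 (fun x => is_ordered_spectrum (\val X) x)); exists x.
Qed.

Lemma Omega_lambda_gt (X : symM R n) (i j : 'I_n) : Omega (lambda X) ->
  (i < j)%N -> lambda X 0 j < lambda X 0 i.
Proof.
move=> OX ij; have [xs _] := lambda_spectrum OX.
rewrite lt_neqAle xs ?(ltnW ij) // andbT; apply: OX.
by rewrite eq_sym neq_ltn ij.
Qed.

(** The open intervals ]x_i - e, x_i + e[ are disjoint, and a sign change of
    the characteristic polynomial forces a root in each: these are n distinct
    roots of a monic polynomial of degree n, hence all of them. In particular
    the existence of real eigenvalues comes for free. *)
Lemma locate_spectrum Y (x : 'rV[R]_n) (e : R) :
  (forall i j : 'I_n, (i < j)%N -> x 0 j + e <= x 0 i - e) -> 0 < e ->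
  (forall i, (char_poly Y).[x 0 i - e] * (char_poly Y).[x 0 i + e] < 0) ->
  exists y, [/\ is_ordered_spectrum Y y, Omega y & forall i, `|x 0 i - y 0 i| < e].
Proof.
move=> gap e0 sgn.
have /choice[z zP] (i : 'I_n) : exists z, `|x 0 i - z| < e /\ root (char_poly Y) z.
  have le : x 0 i - e <= x 0 i + e by rewrite lerD2l (le_trans _ (ltW e0)) // oppr_le0 ltW.
  have [p pE [z zab rz]] : exists2 p, (p = char_poly Y \/ p = - char_poly Y) &
      exists2 z, x 0 i - e <= z <= x 0 i + e & root p z.
    have [sa|sa|sa] := ltrgtP ((char_poly Y).[x 0 i - e]) 0.
    - exists (char_poly Y); first by left.
      apply: poly_ivt => //; rewrite (ltW sa) /= ltW //.
      by rewrite -(nmulr_rlt0 _ sa).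
    - exists (- char_poly Y); first by right.
      apply: poly_ivt => //; rewrite !hornerN oppr_le0 (ltW sa) oppr_ge0 ltW //.
      by rewrite -(pmulr_rlt0 _ sa).
    - by have := sgn i; rewrite sa mul0r ltxx.
  have {}rz : root (char_poly Y) z.
    by case: pE rz => -> //; rewrite rootN.
  exists z; split=> //.
  have := sgn i; have [-> |za] := eqVneq (x 0 i - e) z.
    by rewrite (rootP rz) mul0r ltxx.
  have [-> |zb _] := eqVneq (x 0 i + e) z.
    by rewrite (rootP rz) mulr0 ltxx.
  case/andP: zab => az zb'.
  rewrite distrC ltr_distl lt_neqAle za az /= lt_neqAle eq_sym zb zb'.
  by [].
pose y : 'rV[R]_n := \row_i z i.
have ylt (i j : 'I_n) : (i < j)%N -> y 0 j < y 0 i.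
  move=> ij; have := gap _ _ ij; have [+ _] := zP i; have [+ _] := zP j.
  rewrite !mxE !ltr_distlC => /andP[_ h1] /andP[h2 _] h3.
  exact: lt_le_trans h1 (le_trans h3 (ltW h2)).
have Oy : Omega y.
  move=> i j; rewrite neq_ltn => /orP[ij|ij]; first by rewrite gt_eqF // ylt.
  by rewrite lt_eqF // ylt.
exists y; split=> // [|i]; last by rewrite mxE; case: (zP i).
split=> [i j|].
  by rewrite leq_eqVlt => /orP[/eqP/val_inj -> //|ij]; rewrite ltW // ylt.
have := @all_roots_prod_XsubC _ (char_poly Y) [seq y 0 i | i <- enum 'I_n].
rewrite (monicP (char_poly_monic _)) scale1r big_map enumT; apply.
- by rewrite size_char_poly size_map -enumT size_enum_ord.
- by apply/allP => _ /mapP[i _ ->]; rewrite mxE; case: (zP i).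
- rewrite uniq_rootsE map_inj_uniq ?index_enum_uniq // => i j.
  by have [//|/Oy/eqP] := eqVneq i j.
Qed.

End OrderedSpectrum.

(** * The eigenvalues are smooth where they are simple *)
Section SimpleSpectrum.
Variables (R : realType) (n : nat).
Implicit Types (X Y H : symM R n).

Definition simple : set (symM R n) := [set X | Omega (lambda X)].

Lemma det_shiftE (t : R) Y : \det (t%:M - \val Y) =
  \sum_(s : 'S_n) (-1) ^+ s * \prod_i (t * (i == s i)%:R - entry i (s i) Y).
Proof.
apply: eq_bigr => s _; congr (_ * _); apply: eq_bigr => i _.
by rewrite !mxE mulr_natr.
Qed.

(** The derivative of - det (t - Y) in direction H. It is a polynomial in t
    and in the entries of Y, which is what the bootstrap below exploits. *)
Definition ddet (t : R) Y H : R :=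
  \sum_(s : 'S_n) (-1) ^+ s * \sum_i entry i (s i) H *
    \prod_(j | j != i) (t * (j == s j)%:R - entry j (s j) Y).

Lemma is_diff_det_shift t Y :
  is_diff Y (fun Z => - \det (t%:M - \val Z)) (ddet t Y).
Proof.
pose F (s : 'S_n) (i : 'I_n) Z := t * (i == s i)%:R - entry i (s i) Z.
have dF s i : is_diff Y (F s i) (fun H => - entry i (s i) H).
  apply: is_diff_eq (is_diffB (is_diff_cst _ _) (is_diff_entry _ _ _)) _.
  by apply/funext => H; rewrite !fctE sub0r.
have dP (s : {perm 'I_n}) : is_diff Y (fun Z => - (-1) ^+ s * \prod_i F s i Z)
    (fun H => - (-1) ^+ s * \sum_i - entry i (s i) H * \prod_(j | j != i) F s j Y).
  have ui := index_enum_uniq 'I_n.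
  have := is_diffZ (- (-1) ^+ s : R) (is_diff_fprod ui (dF s)).
  exact.
rewrite (_ : (fun Z => _) = fun Z => \sum_(s : 'S_n) (- (-1) ^+ s * \prod_i F s i Z)).
  apply: is_diff_eq; first by apply: is_diff_fsum => s _; exact: dP.
  apply/funext => H; apply: eq_bigr => s _; rewrite mulNr -mulrN -sumrN.
  by congr (_ * _); apply: eq_bigr => i _; rewrite mulNr opprK.
apply/funext => Z; rewrite det_shiftE -sumrN.
by apply: eq_bigr => s _; rewrite mulNr.
Qed.

Lemma det_shift_continuous t : continuous (fun Y => \det (t%:M - \val Y)).
Proof.
move=> Y; have [dd _] := is_diff_det_shift t Y.
rewrite (_ : (fun Z => _) = - (fun Z => - \det (t%:M - \val Z))).
  exact: cvgN (differentiable_continuous dd).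
by apply/funext => Z; rewrite fctE opprK.
Qed.

Lemma det_shift_lambda t Y : simple Y ->
  \det (t%:M - \val Y) = \prod_i (t - lambda Y 0 i).
Proof.
move=> /lambda_spectrum[_ cp]; rewrite -horner_char_poly cp horner_prod.
by apply: eq_bigr => i _; rewrite !hornerE.
Qed.

(** The characteristic polynomial of X takes opposite signs at x_i - d and
    x_i + d when 2 d is at most the least gap, because the product of the two
    values is - d ^ 2 times a product of positive factors. Both values depend
    continuously on the matrix, so the signs persist near X. *)
Lemma near_lambda X (e : R) : simple X -> 0 < e ->
  \forall Y \near X, simple Y /\ forall i, `|lambda X 0 i - lambda Y 0 i| < e.
Proof.
move=> sX e0; set x := lambda X.
have [d [d0 de gap]] : exists d, [/\ 0 < d, d <= e &
    forall i j : 'I_n, (i < j)%N -> x 0 j + d <= x 0 i - d].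
  have : \forall d \near (0 : R)^'+, forall ij : 'I_n * 'I_n,
      (ij.1 < ij.2)%N -> d <= (x 0 ij.1 - x 0 ij.2) / 2.
    apply: filter_forall => -[i j] /=; have [ij|_] := ltnP i j; last exact: filterE.
    have : 0 < (x 0 i - x 0 j) / 2.
      by rewrite divr_gt0 // subr_gt0 Omega_lambda_gt.
    by move=> p0; near=> d => _; near: d; exact: nbhs_right_le.
  move=> dP; have [d [/= dgap [d0 de]]] : exists d, (forall ij : 'I_n * 'I_n,
      (ij.1 < ij.2)%N -> d <= (x 0 ij.1 - x 0 ij.2) / 2) /\ 0 < d /\ d <= e.
    near ((0 : R)^'+) => d; exists d; split; first by near: d.
    by split; [|near: d; exact: nbhs_right_le].
  exists d; split=> // i j /(dgap (i, j)) /=.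
  by rewrite ler_pdivlMr // mulr_natr mulr2n => dd; rewrite -subr_ge0 opprD addrACA -opprD subr_ge0.
have sgn : \forall Y \near X, forall i,
    \det ((x 0 i - d)%:M - \val Y) * \det ((x 0 i + d)%:M - \val Y) < 0.
  apply: (@filter_forall (symM R n) 'I_n (fun i Y => \det ((x 0 i - d)%:M -
    \val Y) * \det ((x 0 i + d)%:M - \val Y) < 0) (nbhs X)) => i.
  apply: (cvgr_lt (\det ((x 0 i - d)%:M - \val X) *
      \det ((x 0 i + d)%:M - \val X))).
    by apply: cvgM; exact: det_shift_continuous.
  rewrite !det_shift_lambda // -big_split (bigD1 i) //= -/x.
  rewrite [x 0 i - d - x 0 i]addrAC subrr sub0r [x 0 i + d - x 0 i]addrAC subrr.
  rewrite add0r mulNr mulNr oppr_lt0 !mulr_gt0 // prodr_gt0 // => j.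
  have dN a : a - d < a + d :> R.
    by rewrite ltrD2l (lt_trans _ d0) // oppr_lt0.
  rewrite neq_ltn => /orP[/gap ji|/gap ij].
    have h : x 0 i + d < x 0 j by rewrite (le_lt_trans ji) // gtrDl oppr_lt0.
    by rewrite nmulr_rgt0 subr_lt0 // (lt_trans (dN _)).
  have h : x 0 j < x 0 i - d by rewrite (lt_le_trans _ ij) // ltrDl.
  by rewrite pmulr_rgt0 subr_gt0 // (lt_trans h).
apply: filterS sgn => Y sgnY.
have [|y [ys Oy yx]] := @locate_spectrum _ _ (\val Y) x d gap d0.
  by move=> i; rewrite !horner_char_poly.
have yE := lambda_eq ys.
rewrite /simple /= yE; split=> // i.
exact: lt_le_trans (yx i) de.
Unshelve. all: by end_near. Qed.

Lemma open_simple : open simple.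
Proof.
rewrite openE => X sX; rewrite /interior.
by apply: filterS (near_lambda sX ltr01) => Y [].
Qed.

Lemma lambda_continuous X i : simple X -> {for X, continuous (fun Y => lambda Y 0 i)}.
Proof.
move=> sX; apply: continuous_at_dist => e e0.
by apply: filterS (near_lambda sX e0) => Y [_]; apply.
Qed.

Definition dlambda i X H : R :=
  ddet (lambda X 0 i) X H / \prod_(j | j != i) (lambda X 0 i - lambda X 0 j).

Lemma lambda_gap_neq0 i X : simple X ->
  \prod_(j | j != i) (lambda X 0 i - lambda X 0 j) != 0.
Proof.
move=> sX; apply/prodf_neq0 => j ji; rewrite subr_eq0; apply: sX.
by rewrite eq_sym.
Qed.

(** With x = lambda X, evaluating the characteristic polynomial of Y at x_i
    gives x_i - lambda_i(Y) = det (x_i - Y) / prod_(j != i) (x_i - lambda_j(Y)).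
    The numerator is differentiable and vanishes at X, the denominator is
    continuous and nonzero there. *)
Lemma is_diff_lambda i X : simple X ->
  is_diff X (fun Y => lambda Y 0 i) (dlambda i X).
Proof.
move=> sX; set x := lambda X.
pose Q Y := \prod_(j | j != i) (x 0 i - lambda Y 0 j).
have Qc : {for X, continuous Q}.
  apply: continuous_fprod => j _; apply: continuousB; first exact: cst_continuous.
  exact: lambda_continuous.
have Q0 : Q X != 0 by exact: lambda_gap_neq0.
have dX0 : - \det ((x 0 i)%:M - \val X) = 0.
  by rewrite det_shift_lambda // (bigD1 i) //= subrr mul0r oppr0.
have := is_diff_mul_vanishing (is_diff_det_shift (x 0 i) X) dX0 (continuousV Q0 Qc).
move=> dGQ.
apply: (@near_is_diff _ _ _ _ (fun Y =>
    x 0 i + (- \det ((x 0 i)%:M - \val Y)) * (Q Y)^-1)).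
  have nQ : \forall Y \near X, Q Y != 0 by exact: cvgr_neq0 Qc Q0.
  near=> Y.
  have sY : simple Y by near: Y; apply: open_nbhs_nbhs; split=> //; exact: open_simple.
  rewrite det_shift_lambda // (bigD1 i) //= -/(Q Y) mulNr mulfK; last by near: Y.
  by rewrite opprB addrC subrK.
have dD := is_diffD (is_diff_cst (x 0 i : R) X) dGQ.
apply: is_diff_eq dD _.
by apply/funext => H; rewrite !fctE add0r.
Unshelve. all: by end_near. Qed.

#[local] Opaque smooth_on.

(** Bootstrap: the derivatives of the eigenvalues are rational functions of
    the eigenvalues and of the entries of the matrix, so one more derivative is
    gained at each step. *)
Lemma smooth_on_lambda c k i : smooth_on c simple k (fun X => lambda X 0 i).
Proof.
have os := open_simple.
elim: k i => [|k IHk] i.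
  by apply/smooth_on0P => _ X; exact: lambda_continuous.
apply: (is_diff_smooth_on os (is_diff_lambda i)) => H.
apply: smooth_onM => //; last first.
  apply: smooth_onV => //; first by move=> X; exact: lambda_gap_neq0.
  by apply: smooth_on_prod => // j _; apply: smooth_onB.
apply: smooth_on_sum => // s _; apply: smooth_onM => //.
  exact: (smooth_on_cst c os).
apply: smooth_on_sum => // l _; apply: smooth_onM => //.
  exact: (smooth_on_cst c os).
apply: smooth_on_prod => // j _; apply: smooth_onB => //.
  by apply: smooth_onM => //; exact: (smooth_on_cst c os).
exact: smooth_on_entry.
Qed.

Lemma smooth_on_comp_lambda c k (f : 'rV[R]_n -> R) :
  smooth_on c setT k f -> smooth_on c simple k (f \o @lambda R n).
Proof.
move=> fs; apply: smooth_on_comp => //; first exact: open_simple.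
by move=> j; exact: smooth_on_lambda.
Qed.

End SimpleSpectrum.

(** * Multilinear forms of diagonal tensors *)
Section TensorForms.
Variables (R : realType) (n : nat).

Lemma sum_upper_lower k (F : {ffun 'I_k -> 'I_n} -> {ffun 'I_k -> 'I_n} -> R) :
  \sum_(i : {ffun 'I_(k + k) -> 'I_n}) F (upper i) (lower i) =
  \sum_u \sum_l F u l.
Proof.
pose merge (p : {ffun 'I_k -> 'I_n} * {ffun 'I_k -> 'I_n}) :
    {ffun 'I_(k + k) -> 'I_n} :=
  [ffun r : 'I_(k + k) => match fintype.split r with inl a => p.1 a | inr b => p.2 b end].
have upperE p : upper (merge p) = p.1.
  by apply/ffunP => r; rewrite !ffunE (unsplitK (inl r)).
have lowerE p : lower (merge p) = p.2.
  by apply/ffunP => r; rewrite !ffunE (unsplitK (inr r)).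
rewrite pair_bigA (reindex merge) /=.
  by apply: eq_bigr => p _; rewrite upperE lowerE.
exists (fun i => (upper i, lower i)) => [p _|i _].
  by rewrite upperE lowerE -surjective_pairing.
apply/ffunP => r; rewrite !ffunE.
by case: splitP => j rj; rewrite ffunE; congr (i _); apply: val_inj.
Qed.

(** Each V of the conjugation is absorbed by the neighbouring matrix
    argument. *)
Lemma tensor_form_conj k (V : 'M[R]_n) (T : tensor R (k + k) n) H :
  tensor_form (tensor_conj V T) H =
  tensor_form T (fun r => V^T *m H r *m V).
Proof.
rewrite /tensor_form.
under eq_bigr => i _ do rewrite ffunE mulr_suml.
rewrite exchange_big; apply: eq_bigr => p _ /=.
under eq_bigr => i _ do rewrite -mulrA; rewrite -mulr_sumr; congr (_ * _).
pose G r a b := V a (upper p r) * V b (lower p r) * H r a b.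
transitivity (\sum_(u : {ffun 'I_k -> 'I_n}) \sum_(l : {ffun 'I_k -> 'I_n})
    \prod_r G r (u r) (l r)).
  rewrite -sum_upper_lower; apply: eq_bigr => i _.
  rewrite big_split_ord /= /G !big_split /=.
  by congr (_ * _ * _); apply: eq_bigr => r _; rewrite !ffunE.
transitivity (\prod_r \sum_a \sum_b G r a b).
  rewrite bigA_distr_bigA; apply: eq_bigr => u _.
  by rewrite (bigA_distr_bigA (fun r b => G r (u r) b)).
apply: eq_bigr => r _; rewrite mxE exchange_big; apply: eq_bigr => b _ /=.
rewrite mxE mulr_suml; apply: eq_bigr => a _; rewrite mxE /G.
by rewrite mulrAC.
Qed.

(** The form defined by Diag^sigma T: the condition i_r = j_(sigma r) leaves
    only the upper indices u free, the lower ones being u \o sigma^-1. *)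
Definition diag_form k (sigma : 'S_k) (T : tensor R k n) (B : 'I_k -> 'M[R]_n) : R :=
  \sum_(u : {ffun 'I_k -> 'I_n}) T u * \prod_r B r (u r) (u ((sigma^-1)%g r)).

Lemma tensor_form_Diag k (sigma : 'S_k) T (B : 'I_k -> 'M[R]_n) :
  tensor_form (Diag_perm sigma T) B = diag_form sigma T B.
Proof.
pose F (u l : {ffun 'I_k -> 'I_n}) := (if [forall r, u r == l (sigma r)] then T u else 0) *
  \prod_(r < k) B r (u r) (l r).
transitivity (\sum_u \sum_l F u l).
  by rewrite -sum_upper_lower; apply: eq_bigr => i _; rewrite !ffunE.
apply: eq_bigr => u _.
pose l0 : {ffun 'I_k -> 'I_n} := [ffun r => u ((sigma^-1)%g r)].
rewrite (bigD1 l0) //= big1 ?addr0 => [|l ll0]; rewrite /F.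
  rewrite ifT; first by congr (_ * _); apply: eq_bigr => r _; rewrite ffunE.
  by apply/forallP => r; rewrite ffunE permK.
case: forallP => [lu|_]; last by rewrite mul0r.
case/eqP: ll0; apply/ffunP => r; rewrite ffunE.
by rewrite (eqP (lu _)) permKV.
Qed.

Lemma tensor_form_sum k (I : finType) (T : I -> tensor R (k + k) n) H :
  tensor_form (\sum_i T i) H = \sum_i tensor_form (T i) H.
Proof.
rewrite /tensor_form exchange_big; apply: eq_bigr => p _ /=.
by rewrite sum_ffunE mulr_suml.
Qed.

End TensorForms.

(** * Adding one index *)
Section IndexExtension.
Variables (n s : nat).
Implicit Types (u : {ffun 'I_s -> 'I_n}).

Definition ext_index u (a : 'I_n) : {ffun 'I_s.+1 -> 'I_n} :=
  [ffun r => if unlift ord_max r is Some r' then u r' else a].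

Definition upd_index u (l : 'I_s) (a : 'I_n) : {ffun 'I_s -> 'I_n} :=
  [ffun r => if r == l then a else u r].

Lemma ext_index_lift u a r : ext_index u a (lift ord_max r) = u r.
Proof. by rewrite ffunE liftK. Qed.

Lemma ext_index_max u a : ext_index u a ord_max = a.
Proof. by rewrite ffunE unlift_none. Qed.

Lemma init_ext_index u a : init_index (ext_index u a) = u.
Proof. by apply/ffunP => r; rewrite ffunE ext_index_lift. Qed.

Lemma upd_indexK u l a : upd_index (upd_index u l a) l (u l) = u.
Proof. by apply/ffunP => r; rewrite !ffunE; case: eqP => [->|]. Qed.

Lemma upd_index_eq u l a : upd_index u l a l = a.
Proof. by rewrite ffunE eqxx. Qed.

Lemma sum_ext_index (R : realType) (F : {ffun 'I_s.+1 -> 'I_n} -> R) :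
  \sum_i F i = \sum_u \sum_a F (ext_index u a).
Proof.
rewrite pair_bigA (reindex (fun p => ext_index p.1 p.2)) //=.
exists (fun i => (init_index i, i ord_max)) => [[u a] _|i _] /=.
  by rewrite init_ext_index ext_index_max.
apply/ffunP => r; rewrite ffunE.
by case: unliftP => [j|] ->; rewrite ?ffunE.
Qed.

(** Exchanging a with the l-th entry of u is an involution on the pairs
    (u, a). *)
Lemma sum_upd_index (R : realType) l
    (F : {ffun 'I_s -> 'I_n} -> 'I_n -> R) :
  \sum_u \sum_a F (upd_index u l a) (u l) = \sum_u \sum_a F u a.
Proof.
pose swap (p : {ffun 'I_s -> 'I_n} * 'I_n) := (upd_index p.1 l p.2, p.1 l).
have swapK : involutive swap.
  by case=> u a; rewrite /swap /= upd_indexK upd_index_eq.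
rewrite !pair_bigA [RHS](reindex swap) //.
by exists swap => p _; exact: swapK.
Qed.

(** Since sigma_(l) sends l to the new index s+1, and s+1 to sigma l, the
    inverse of sigma_(l) reads the indices as that of sigma does, except that
    the new index a stands in for u_l. *)
Lemma perm_extV_lift (sigma : 'S_s) l r u a :
  ext_index u a ((perm_ext sigma (lift ord_max l))^-1 (lift ord_max r))%g =
  upd_index u l a ((sigma^-1)%g r).
Proof.
rewrite /perm_ext invMg permM lift_permV lift_perm_lift tpermV [RHS]ffunE.
case: eqP => [->|/eqP ne]; first by rewrite tpermL ext_index_max.
rewrite tpermD ?ext_index_lift //; last exact: neq_lift.
by rewrite (inj_eq lift_inj) eq_sym.
Qed.

Lemma perm_extV_lift_max (sigma : 'S_s) l :
  ((perm_ext sigma (lift ord_max l))^-1 ord_max)%g = lift ord_max l.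
Proof. by rewrite /perm_ext invMg permM lift_permV lift_perm_id tpermV tpermR. Qed.

Lemma perm_extV_max (sigma : 'S_s) r :
  ((perm_ext sigma ord_max)^-1 (lift ord_max r))%g = lift ord_max ((sigma^-1)%g r).
Proof. by rewrite /perm_ext tperm1 mul1g lift_permV lift_perm_lift. Qed.

Lemma perm_extV_max_max (sigma : 'S_s) :
  ((perm_ext sigma ord_max)^-1 ord_max)%g = ord_max.
Proof. by rewrite /perm_ext tperm1 mul1g lift_permV lift_perm_id. Qed.

End IndexExtension.

Lemma big_ord_lift_max (T : Type) (idx : T) (op : Monoid.law idx) s
    (F : 'I_s.+1 -> T) :
  \big[op/idx]_(r < s.+1) F r =
  op (\big[op/idx]_(r < s) F (lift ord_max r)) (F ord_max).
Proof.
rewrite big_ord_recr; congr (op _ _); apply: eq_bigr => r _; congr F.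
by apply: val_inj; rewrite /= /bump leqNgt ltn_ord.
Qed.

(** * The derivative of a diagonal form, as a sum of diagonal forms *)
Section DifferentiatedDiagonalForm.
Variables (R : realType) (n s : nat) (sigma : 'S_s).
Variables (A : 'rV[R]_n -> tensor R s n) (x : 'rV[R]_n).
Variables (B : 'I_s.+1 -> 'M[R]_n).

Let B' r := B (lift ord_max r).
Let D := B ord_max.

(** If V(t) is a differentiable orthogonal eigenbasis of X + t H, with
    eigenvalues x at t = 0 and D = V^T H V, this is V^T V' at t = 0. *)
Definition rotation (x : 'rV[R]_n) (D : 'M[R]_n) : 'M[R]_n :=
  \matrix_(a, b) if a == b then 0 else D a b / (x 0 b - x 0 a).

Let K := rotation x D.

Let prodB (u v : {ffun 'I_s -> 'I_n}) : R :=
  \prod_r B' r (u r) (v ((sigma^-1)%g r)).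

Lemma diag_form_grad :
  diag_form (perm_ext sigma ord_max) (tensor_grad A x) B =
  \sum_u (\sum_a D a a * 'D_(delta_mx 0 a) (fun y => A y u : R^o) x) * prodB u u.
Proof.
rewrite /diag_form sum_ext_index; apply: eq_bigr => u _; rewrite mulr_suml.
apply: eq_bigr => a _; rewrite big_ord_lift_max /= perm_extV_max_max.
rewrite ffunE ext_index_max init_ext_index mulrA mulrC mulrA; congr (_ * _).
by apply: eq_bigr => r _; rewrite perm_extV_max !ext_index_lift.
Qed.

Lemma tensor_out_ext l u a : tensor_out A l x (ext_index u a) =
  if u l == a then 0
  else (A x (upd_index u l a) - A x u) / (x 0 a - x 0 (u l)).
Proof. by rewrite ffunE /= ext_index_lift ext_index_max init_ext_index. Qed.

(** In A_out the entry of A at u[l := a] and the entry at u come with opposite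
    signs. The involution of [sum_upd_index] brings the first kind back to u,
    which moves the replacement of u_l by a from the right index of the product
    to the left one; the divided differences become the entries of K. *)
Lemma diag_form_out l :
  diag_form (perm_ext sigma (lift ord_max l)) (tensor_out A l x) B =
  \sum_u A x u * \sum_a (K a (u l) * prodB u (upd_index u l a)
                         - K (u l) a * prodB (upd_index u l a) u).
Proof.
have -> : diag_form (perm_ext sigma (lift ord_max l)) (tensor_out A l x) B =
    \sum_u \sum_a (A x u * (K a (u l) * prodB u (upd_index u l a))
      - A x (upd_index u l a) * (K a (u l) * prodB u (upd_index u l a))).
  rewrite /diag_form sum_ext_index; apply: eq_bigr => u _.
  apply: eq_bigr => a _; rewrite big_ord_lift_max /= perm_extV_lift_max.
  under eq_bigr => r _ do rewrite perm_extV_lift ext_index_lift.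
  rewrite -/(prodB u (upd_index u l a)).
  rewrite tensor_out_ext ext_index_max ext_index_lift mxE [u l == a]eq_sym.
  case: eqP => [_|_]; first by rewrite !(mul0r, mulr0) subrr.
  rewrite -mulrBl -opprB -[x 0 a - x 0 (u l)]opprB invrN mulrNN.
  rewrite -!mulrA; congr (_ * _).
  by rewrite mulrA mulrC.
under eq_bigr => u _ do rewrite big_split /=.
rewrite big_split /=.
rewrite -(sum_upd_index l (fun u a => - (A x (upd_index u l a) * _))).
rewrite -big_split /=; apply: eq_bigr => u _; rewrite mulr_sumr -big_split /=.
apply: eq_bigr => a _; rewrite mulrBr; congr (_ - _).
by rewrite upd_indexK upd_index_eq.
Qed.

Lemma prodB_updl u l a : prodB (upd_index u l a) u =
  B' l a (u ((sigma^-1)%g l)) *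
  \prod_(r | r != l) B' r (u r) (u ((sigma^-1)%g r)).
Proof.
rewrite /prodB (bigD1 l) //= upd_index_eq; congr (_ * _).
by apply: eq_bigr => r /negbTE rl; rewrite ffunE rl.
Qed.

Lemma prodB_updr u l a : prodB u (upd_index u l a) =
  B' (sigma l) (u (sigma l)) a *
  \prod_(r | r != sigma l) B' r (u r) (u ((sigma^-1)%g r)).
Proof.
rewrite /prodB (bigD1 (sigma l)) //= permK upd_index_eq; congr (_ * _).
apply: eq_bigr => r /negbTE rl; rewrite ffunE.
by rewrite -(inj_eq (@perm_inj _ sigma)) permKV rl.
Qed.

(** The index u_l occurs twice in the product over r: on the left in
    the factor l and on the right in the factor sigma l. So the two terms of
    [diag_form_out], summed over l, are the two terms of the commutators
    B' r *m K - K *m B' r, summed over r; for the occurrences on the right,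
    r = sigma l. *)
Lemma sum_diag_form_ext :
  \sum_(l < s.+1) diag_form (perm_ext sigma l) (tensor_ext A l x) B =
  \sum_u ((\sum_a D a a * 'D_(delta_mx 0 a) (fun y => A y u : R^o) x) *
            (\prod_r B' r (u r) (u ((sigma^-1)%g r))) +
    A x u * \sum_r (B' r *m K - K *m B' r) (u r) (u ((sigma^-1)%g r)) *
       \prod_(q | q != r) B' q (u q) (u ((sigma^-1)%g q))).
Proof.
rewrite big_ord_lift_max /= [X in _ + X](_ : _ =
  diag_form (perm_ext sigma ord_max) (tensor_grad A x) B); last first.
  by rewrite /tensor_ext unlift_none.
rewrite diag_form_grad addrC [RHS]big_split /=; congr (_ + _).
under eq_bigr => l _ do rewrite /tensor_ext liftK diag_form_out.
rewrite exchange_big; apply: eq_bigr => u _ /=; rewrite -mulr_sumr.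
congr (_ * _).
under [LHS]eq_bigr => l _ do rewrite big_split /=.
rewrite [LHS]big_split /=.
under [RHS]eq_bigr => r _ do rewrite mxE mulrDl.
rewrite [RHS]big_split /=; congr (_ + _).
  rewrite [RHS](reindex_inj (@perm_inj _ sigma)); apply: eq_bigr => l _ /=.
  rewrite mxE mulr_suml permK; apply: eq_bigr => a _.
  by rewrite prodB_updr mulrA [K _ _ * _]mulrC.
apply: eq_bigr => l _; rewrite !mxE mulNr mulr_suml -sumrN.
by apply: eq_bigr => a _; rewrite prodB_updl mulrA.
Qed.

End DifferentiatedDiagonalForm.

(** * Differentials of matrix-valued maps *)
Section MatrixDifferential.
Variables (R : realType) (V : normedModType R) (x : V).

Definition mx_diff m p (M DM : V -> 'M[R]_(m, p)) : Prop :=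
  forall a b, is_diff x (fun y => M y a b) (fun h => DM h a b).

Lemma mx_diff_cst m p (M : 'M[R]_(m, p)) : mx_diff (fun=> M) (fun=> 0).
Proof.
move=> a b; apply: is_diff_eq (is_diff_cst (M a b) x) _.
by apply/funext => h; rewrite mxE.
Qed.

Lemma mx_diff_mul m p q (M DM : V -> 'M[R]_(m, p)) (N DN : V -> 'M[R]_(p, q)) :
  mx_diff M DM -> mx_diff N DN ->
  mx_diff (fun y => M y *m N y) (fun h => DM h *m N x + M x *m DN h).
Proof.
move=> dM dN a b.
rewrite (_ : (fun y => _) = fun y => \sum_c M y a c * N y c b); last first.
  by apply/funext => y; rewrite mxE.
apply: is_diff_eq.
  by apply: is_diff_fsum => c _; apply: is_diff_mul; [exact: dM|exact: dN].
apply/funext => h; rewrite !mxE -big_split; apply: eq_bigr => c _ /=.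
by rewrite addrC [N x c b * _]mulrC.
Qed.

Lemma mx_diff_tr m p (M DM : V -> 'M[R]_(m, p)) :
  mx_diff M DM -> mx_diff (fun y => (M y)^T) (fun h => (DM h)^T).
Proof.
move=> dM a b; apply: near_is_diff.
  by apply: nearW => y; rewrite mxE; reflexivity.
apply: is_diff_eq (dM b a) _.
by apply/funext => h; rewrite mxE.
Qed.

(** Uniqueness of the differential turns a matrix identity valid near x into
    an identity between derivatives. *)
Lemma near_mx_diff m p (M DM N DN : V -> 'M[R]_(m, p)) :
  (\forall y \near x, M y = N y) -> mx_diff M DM -> mx_diff N DN -> DM = DN.
Proof.
move=> MN dM dN; apply/funext => h; apply/matrixP => a b.
have dMN : is_diff x (fun y => M y a b) (fun h => DN h a b).
  by apply: near_is_diff (dN a b); apply: filterS MN => y ->.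
have [_ E1] := dM a b; have [_ E2] := dMN.
by have := congr1 (fun f => f h) (etrans (esym E1) E2).
Qed.

End MatrixDifferential.

Section DifferentiableFunctions.
Variables (R : realType) (V : normedModType R).
Implicit Types (F G : V -> R) (x : V).

Lemma differentiable_sqrt F x : 0 < F x -> differentiable F x ->
  differentiable (fun y => Num.sqrt (F y)) x.
Proof.
move=> F0 dF; apply: (differentiable_comp dF).
by apply/derivable1_diffP; have [] := is_derive1_sqrt F0.
Qed.

Lemma differentiable_mulmx m p q (M : V -> 'M[R]_(m, p)) (N : V -> 'M[R]_(p, q)) x :
  (forall a b, differentiable (fun y => M y a b) x) ->
  (forall a b, differentiable (fun y => N y a b) x) ->
  forall a b, differentiable (fun y => (M y *m N y) a b) x.
Proof.
move=> dM dN a b.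
have [] // := @mx_diff_mul _ _ x _ _ _ M (fun h => \matrix_(a, b)
  'd (fun y => M y a b) x h) N (fun h => \matrix_(a, b)
  'd (fun y => N y a b) x h) _ _ a b.
  move=> {}a {}b; split; first exact: dM.
  by apply/funext => h; rewrite mxE.
move=> {}a {}b; split; first exact: dN.
by apply/funext => h; rewrite mxE.
Qed.

End DifferentiableFunctions.

(** * A differentiable eigenbasis *)
Section EigenvectorFactors.
Variables (R : realType) (n : nat).
Implicit Types (X Y : symM R n).

(** Up to a nonzero scalar this is the spectral projection for the i-th
    eigenvalue: it kills the other eigenspaces. *)
Definition eigen_annihilator (i : 'I_n) Y : 'M[R]_n :=
  \big[mulmx/1%:M]_(j <- index_enum 'I_n | j != i) (\val Y - (lambda Y 0 j)%:M).

(** The product with the missing factor is the characteristic polynomial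
    evaluated at Y, which is zero by Cayley-Hamilton. *)
Lemma eigen_annihilatorP i Y : simple Y ->
  (\val Y - (lambda Y 0 i)%:M) *m eigen_annihilator i Y = 0.
Proof.
move=> /lambda_spectrum[_]; rewrite /eigen_annihilator.
move: (\val Y) (lambda Y) => {}Y; case: n Y i => [|m] Y i l cp; first by case: i.
pose q := \prod_(j | j != i) ('X - (l 0 j)%:P).
have hE p : horner_mx Y ('X - p%:P) = Y - p%:M.
  by rewrite rmorphB /= horner_mx_X horner_mx_C.
have -> : \big[mulmx/1%:M]_(j <- index_enum 'I_m.+1 | j != i) (Y - (l 0 j)%:M) =
    horner_mx Y q.
  rewrite rmorph_prod; apply: eq_bigr => j _; exact/esym/hE.
have cq : char_poly Y = ('X - (l 0 i)%:P) * q by rewrite cp (bigD1 i).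
rewrite -hE -[_ *m _]rmorphM -cq.
exact: Cayley_Hamilton.
Qed.

Lemma eigen_annihilator_eigenvector i Y (v : 'cV[R]_n) :
  \val Y *m v = lambda Y 0 i *: v ->
  eigen_annihilator i Y *m v =
    (\prod_(j | j != i) (lambda Y 0 i - lambda Y 0 j)) *: v.
Proof.
move=> Yv; rewrite /eigen_annihilator; elim: (index_enum _) => [|j r IHr].
  by rewrite !big_nil mul1mx scale1r.
rewrite !big_cons; case: ifP => // _.
rewrite -mulmxA IHr -scalemxAr mulmxBl Yv mul_scalar_mx -scalerBl scalerA.
by rewrite mulrC.
Qed.

Lemma differentiable_eigen_annihilator i X : simple X -> forall a b,
  differentiable (fun Y => eigen_annihilator i Y a b) X.
Proof.
move=> sX; rewrite /eigen_annihilator; elim: (index_enum _) => [|j r IHr] a b.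
  rewrite (_ : (fun Y => _) = cst (1%:M a b)); first exact: differentiable_cst.
  by apply/funext => Y; rewrite big_nil.
case: (boolP (j != i)) => ji; last first.
  rewrite (_ : (fun Y => _) = fun Y : symM R n => (\big[mulmx/1%:M]_(j <- r | j != i)
    (\val Y - (lambda Y 0 j)%:M)) a b) //.
  by apply/funext => Y; rewrite big_cons (negbTE ji).
rewrite (_ : (fun Y => _) = fun Y : symM R n => ((\val Y - (lambda Y 0 j)%:M) *m
  \big[mulmx/1%:M]_(j <- r | j != i) (\val Y - (lambda Y 0 j)%:M)) a b).
  apply: differentiable_mulmx => {}a {}b; last exact: IHr.
  rewrite (_ : (fun Y => _) = entry a b - (a == b)%:R \*o (fun Y => lambda Y 0 j)).
    apply: differentiableB; first by have [] := is_diff_entry a b X.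
    by apply: differentiableZ; have [] := is_diff_lambda j sX.
  by apply/funext => Y; rewrite !fctE !mxE /= mulr_natl.
by apply/funext => Y; rewrite big_cons ji.
Qed.

End EigenvectorFactors.

Section EigenbasisGerm.
Variables (R : realType) (n : nat) (X : symM R n) (V : 'M[R]_n).
Hypotheses (sX : simple X) (dV : diagonalizes V X).

Lemma diagonalizes_mul : \val X *m V = V *m diag_mx (lambda X).
Proof.
by have [VV ->] := dV; rewrite -mulmxA (mulmx1C VV) mulmx1.
Qed.

Lemma diagonalizes_col i : \val X *m col i V = lambda X 0 i *: col i V.
Proof.
rewrite [in LHS]colE mulmxA diagonalizes_mul mul_mx_diag -colE.
by apply/colP => a; rewrite !mxE mulrC.
Qed.

(* [w i Y] is an eigenvector of Y for its i-th eigenvalue; the constant gap i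
   normalises it so that [w i X] is the i-th column of V. *)
Let gap i := \prod_(j | j != i) (lambda X 0 i - lambda X 0 j).

Let w i (Y : symM R n) : 'cV[R]_n :=
  (gap i)^-1 *: (eigen_annihilator i Y *m col i V).

Let N i (Y : symM R n) := \sum_a w i Y a 0 * w i Y a 0.

Definition eigenbasis (Y : symM R n) : 'M[R]_n :=
  \matrix_(a, i) (w i Y a 0 / Num.sqrt (N i Y)).

Let wX i : w i X = col i V.
Proof.
rewrite /w eigen_annihilator_eigenvector; last exact: diagonalizes_col.
by rewrite scalerA mulVf ?scale1r //; exact: lambda_gap_neq0.
Qed.

Let NX i : N i X = 1.
Proof.
have [/mulmx1C/matrixP/(_ i i) + _] := dV; rewrite !mxE eqxx mulr1n => <-.
by apply: eq_bigr => a _; rewrite wX !mxE.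
Qed.

Lemma eigenbasis_base : eigenbasis X = V.
Proof. by apply/matrixP => a i; rewrite mxE NX sqrtr1 divr1 wX mxE. Qed.

Let differentiable_w i a b : differentiable (fun Y => w i Y a b) X.
Proof.
rewrite (_ : (fun Y => _) = (gap i)^-1 \*:
    (fun Y => (eigen_annihilator i Y *m col i V) a b)).
  apply: differentiableZ; apply: differentiable_mulmx => {}a {}b.
    exact: differentiable_eigen_annihilator.
  exact: (differentiable_cst (col i V a b) X).
by apply/funext => Y; rewrite mxE.
Qed.

Let differentiable_N i : differentiable (N i) X.
Proof.
have [] // := @is_diff_fsum _ _ _ _ (index_enum 'I_n) xpredT
  (fun a (Y : symM R n) => w i Y a 0 * w i Y a 0)
  (fun a h => 'd (fun Y => w i Y a 0 * w i Y a 0) X h) X _.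
by move=> a _; split=> //; apply: differentiableM; exact: differentiable_w.
Qed.

Lemma mx_diff_eigenbasis : exists DW, mx_diff X eigenbasis DW.
Proof.
exists (fun h => \matrix_(a, b) 'd (fun Y => eigenbasis Y a b) X h) => a b.
split; last by apply/funext => h; rewrite mxE.
rewrite (_ : (fun Y => _) = (fun Y => w b Y a 0) *
    (fun Y => (Num.sqrt (N b Y))^-1)); last first.
  by apply/funext => Y; rewrite mxE.
apply: differentiableM; first exact: differentiable_w.
apply: differentiableV; last by rewrite NX sqrtr1 oner_neq0.
by apply: differentiable_sqrt; rewrite ?NX.
Qed.

(** Near X the vectors w i Y are nonzero; being eigenvectors of a symmetric
    matrix for distinct eigenvalues, they are orthogonal. *)
Lemma near_eigenbasis : \forall Y \near X, simple Y /\ diagonalizes (eigenbasis Y) Y.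
Proof.
have nN0 : \forall Y \near X, forall i, 0 < N i Y.
  apply: (@filter_forall (symM R n) 'I_n (fun i Y => 0 < N i Y) (nbhs X)) => i.
  apply: (cvgr_gt (N i X)); last by rewrite NX.
  exact: differentiable_continuous.
have nsY : \forall Y \near X, simple Y.
  by apply: open_nbhs_nbhs; split=> //; exact: open_simple.
near=> Y; have sY : simple Y by near: Y.
have N0 : forall i, 0 < N i Y by near: Y.
split=> //.
have wE i : \val Y *m w i Y = lambda Y 0 i *: w i Y.
  apply/eqP; rewrite -subr_eq0 -mul_scalar_mx -mulmxBl /w -scalemxAr mulmxA.
  by rewrite eigen_annihilatorP // mul0mx scaler0.
set W := eigenbasis Y.
have WE a i : W a i = w i Y a 0 / Num.sqrt (N i Y) by rewrite mxE.
have YW : \val Y *m W = W *m diag_mx (lambda Y).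
  apply/matrixP => a i; rewrite mul_mx_diag [LHS]mxE [RHS]mxE WE.
  have /colP/(_ a) := wE i; rewrite [LHS]mxE [RHS]mxE => E.
  rewrite mulrAC [w i Y a 0 * _]mulrC -E mulr_suml.
  by apply: eq_bigr => b _; rewrite WE mulrA.
have sym : (\val Y)^T = \val Y.
  by case: (Y) => M /= ; rewrite symmetricmxE => /eqP <-.
have WtW : W^T *m W = 1%:M.
  have DG : diag_mx (lambda Y) *m (W^T *m W) = (W^T *m W) *m diag_mx (lambda Y).
    rewrite -[RHS]mulmxA -YW mulmxA [RHS]mulmxA; congr (_ *m _).
    have /(congr1 trmx) := YW; rewrite !trmx_mul tr_diag_mx => <-.
    by rewrite sym.
  apply/matrixP => i j; have [<-|ij] := eqVneq i j.
    rewrite mxE [RHS]mxE eqxx.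
    transitivity (\sum_a w i Y a 0 * w i Y a 0 / N i Y).
      apply: eq_bigr => a _; rewrite mxE !WE mulrACA -invfM.
      rewrite -[Num.sqrt _ * _]expr2.
      by rewrite sqr_sqrtr // ltW.
    rewrite -mulr_suml; exact: (mulfV (lt0r_neq0 (N0 i))).
  rewrite [RHS]mxE (negbTE ij).
  move: DG; move: (W^T *m W) => G /matrixP/(_ i j).
  rewrite mul_diag_mx mul_mx_diag !mxE => /eqP; rewrite -subr_eq0 mulrC -mulrBr mulf_eq0 subr_eq0.
  by case/orP => [/eqP //|/eqP lij]; have := sY _ _ ij; rewrite lij eqxx.
split; first exact: mulmx1C.
by rewrite -YW -mulmxA (mulmx1C WtW) mulmx1.
Unshelve. all: by end_near. Qed.

(** Put K = V^T DW. Differentiating W^T W = 1 shows that K is skew, and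
    differentiating Y W = W diag(lambda Y) at X gives, with x = lambda X,
    D + diag(x) K = K diag(x) + diag(D_H lambda). The diagonal entries give the
    derivatives of the eigenvalues, the others give K. *)
Lemma derivative_eigenbasis (DW : symM R n -> 'M[R]_n) : mx_diff X eigenbasis DW ->
  forall H, let D := V^T *m \val H *m V in
  DW H = V *m rotation (lambda X) D /\ forall a, dlambda a X H = D a a.
Proof.
move=> dW H D; have [VV _] := dV; have VtV := mulmx1C VV.
pose K := V^T *m DW H.
have DWE : DW H = V *m K by rewrite /K mulmxA VV mul1mx.
have skew : K^T + K = 0.
  have nE : \forall Y \near X, (eigenbasis Y)^T *m eigenbasis Y = 1%:M.
    by apply: filterS near_eigenbasis => Y [_ [+ _]] => /mulmx1C.
  have := near_mx_diff nE (mx_diff_mul (mx_diff_tr dW) dW)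
    (mx_diff_cst X (1%:M : 'M[R]_n)).
  move=> /(congr1 (fun f => f H)) /=; rewrite eigenbasis_base.
  by rewrite /K trmx_mul trmxK.
have dvalX : mx_diff X (fun Y => \val Y : 'M[R]_n) (fun H => \val H).
  by move=> a b; exact: is_diff_entry.
have ddiag : mx_diff X (fun Y => diag_mx (lambda Y))
    (fun H => diag_mx (\row_a dlambda a X H)).
  move=> a b; have [<-|ab] := eqVneq a b.
    rewrite (_ : (fun Y => _) = fun Y => lambda Y 0 a).
      apply: is_diff_eq (is_diff_lambda a sX) _.
      by apply/funext => h; rewrite !mxE eqxx.
    by apply/funext => Y; rewrite mxE eqxx.
  rewrite (_ : (fun Y => _) = cst 0).
    apply: is_diff_eq (is_diff_cst (0 : R) X) _.
    by apply/funext => h; rewrite mxE (negbTE ab).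
  by apply/funext => Y; rewrite mxE (negbTE ab).
have main : D + diag_mx (lambda X) *m K =
    K *m diag_mx (lambda X) + diag_mx (\row_a dlambda a X H).
  have nE : \forall Y \near X,
      \val Y *m eigenbasis Y = eigenbasis Y *m diag_mx (lambda Y).
    apply: filterS near_eigenbasis => Y [_ [+ YE]] => /mulmx1C WW.
    by rewrite [in LHS]YE -mulmxA WW mulmx1.
  have := near_mx_diff nE (mx_diff_mul dvalX dW) (mx_diff_mul dW ddiag).
  move=> /(congr1 (fun f => V^T *m f H)) /=; rewrite eigenbasis_base.
  rewrite !mulmxDr !mulmxA VtV mul1mx -/D -/K => <-.
  congr (_ + _); rewrite -[in RHS]mulmxA.
  have [_ XE] := dV.
  by rewrite XE !mulmxA VtV mul1mx.
have Kaa a : K a a = 0.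
  have /matrixP/(_ a a)/eqP := skew; rewrite !mxE -mulr2n mulrn_eq0 /=.
  by move/eqP.
have mainE a b : D a b + lambda X 0 a * K a b =
    K a b * lambda X 0 b + dlambda b X H *+ (a == b).
  have /matrixP/(_ a b) := main; rewrite mul_diag_mx mul_mx_diag.
  by rewrite !mxE; case: eqP => // ->.
split; last first.
  move=> a; have := mainE a a; rewrite Kaa mulr0 mul0r addr0 add0r eqxx.
  by [].
rewrite DWE; congr (_ *m _); apply/matrixP => a b; rewrite [RHS]mxE.
have [<-|ab] := eqVneq a b; first exact: Kaa.
have := mainE a b; rewrite (negbTE ab) addr0.
have ne : lambda X 0 b - lambda X 0 a != 0.
  by rewrite subr_eq0; apply: sX; rewrite eq_sym.
move=> E; apply: (mulIf ne); rewrite divfK // mulrBr -E.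
by rewrite mulrC addrK.
Qed.

End EigenbasisGerm.

Lemma trmx_rotation (R : realType) n (x : 'rV[R]_n) (D : 'M[R]_n) :
  D^T = D -> (rotation x D)^T = - rotation x D.
Proof.
move=> Dt; apply/matrixP => a b; rewrite !mxE eq_sym -[in LHS]Dt mxE.
by case: eqP => _; rewrite ?oppr0 // -mulrN -invrN opprB.
Qed.

(** * Differentiating spectral forms *)
Section DerivativeOfSpectralForms.
Variables (R : realType) (n s : nat) (X : symM R n) (V : 'M[R]_n).
Hypotheses (sX : simple X) (dV : diagonalizes V X).
Variables (A : 'S_s -> 'rV[R]_n -> tensor R s n).
Hypothesis dA : forall sigma u,
  differentiable (fun x => A sigma x u) (lambda X).

Let W := eigenbasis X V.

(** By the product rule the derivative consists of the derivatives of the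
    coefficients A(lambda(Y)), which produce the gradient, and of those of the
    matrices W^T H_r W, which are the commutators with the skew matrix K. *)
Lemma is_diff_diag_form sigma (H : 'I_s -> symM R n) :
  let C h := V^T *m \val h *m V in
  is_diff X
    (fun Y => diag_form sigma (A sigma (lambda Y))
      (fun r => (W Y)^T *m \val (H r) *m W Y))
    (fun h => \sum_(l < s.+1) diag_form (perm_ext sigma l)
      (tensor_ext (A sigma) l (lambda X))
      (fun r => if unlift ord_max r is Some r' then C (H r') else C h)).
Proof.
move=> C; have [DW dW] := mx_diff_eigenbasis sX dV.
have WX : W X = V by exact: eigenbasis_base.
have dWE h := derivative_eigenbasis sX dV dW h.
pose K h := rotation (lambda X) (C h).
have KT h : (K h)^T = - K h.
  apply: trmx_rotation; have hsym : (\val h)^T = \val h.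
    by case: h => M /=; rewrite symmetricmxE => /eqP <-.
  by rewrite /C !trmx_mul trmxK hsym mulmxA.
have dB r a b : is_diff X (fun Y => ((W Y)^T *m \val (H r) *m W Y) a b)
    (fun h => (C (H r) *m K h - K h *m C (H r)) a b).
  apply: is_diff_eq.
    exact: (mx_diff_mul (mx_diff_mul (mx_diff_tr dW) (mx_diff_cst X (\val (H r)))) dW).
  apply/funext => h; rewrite -/W WX mulmx0 addr0 (dWE h).1 -/(K h).
  by rewrite trmx_mul KT !mulNmx addrC /C !mulmxA.
pose F u Y := A sigma (lambda Y) u *
  \prod_r ((W Y)^T *m \val (H r) *m W Y) (u r) (u ((sigma^-1)%g r)).
have dF u : is_diff X (F u) (fun h => A sigma (lambda X) u *
    (\sum_r (C (H r) *m K h - K h *m C (H r)) (u r) (u ((sigma^-1)%g r)) *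
      \prod_(q | q != r) C (H q) (u q) (u ((sigma^-1)%g q))) +
    (\prod_r C (H r) (u r) (u ((sigma^-1)%g r))) *
    \sum_a C h a a * 'd (fun x => A sigma x u) (lambda X) (delta_mx 0 a)).
  have dprod := is_diff_fprod (index_enum_uniq 'I_s)
    (fun r => dB r (u r) (u ((sigma^-1)%g r))).
  have dcomp := is_diff_comp_row (dA sigma u) (fun a => is_diff_lambda a sX).
  apply: is_diff_eq (is_diff_mul dcomp dprod) _.
  apply/funext => h; rewrite WX /=; congr (_ * _ + _ * _).
  by apply: eq_bigr => a _; rewrite (dWE h).2.
apply: is_diff_eq.
  by apply: (is_diff_fsum _ (F := F)) => u _; exact: dF.
apply/funext => h; rewrite sum_diag_form_ext; apply: eq_bigr => u _.
rewrite addrC [X in X + _]mulrC unlift_none; congr (_ * _ + _ * _).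
- by apply: eq_bigr => a _; rewrite deriveE.
- by apply: eq_bigr => r _; rewrite liftK.
- apply: eq_bigr => r _; rewrite liftK; congr (_ * _).
  by apply: eq_bigr => q _; rewrite liftK.
Qed.

End DerivativeOfSpectralForms.

Lemma times_differentiable1 (R : realType) (V : normedModType R) c k
    (F : V -> R) x :
  (0 < k)%N -> times_differentiable c k F x -> differentiable F x.
Proof.
case: k => // k _.
have nd : ndifferentiable F k.+1 x -> differentiable F x.
  elim: k => [[_]|k IHk /ndifferentiable_nbhs //].
  by apply; case.
by case: c => [/nd|[/nbhs_singleton/nd]].
Qed.

Lemma tensor_form_spectral (R : realType) n s (I : finType) (tau : I -> 'S_s)
    (T : I -> tensor R s n) (V : 'M[R]_n) H :
  tensor_form (tensor_conj V (\sum_i Diag_perm (tau i) (T i))) H =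
  \sum_i diag_form (tau i) (T i) (fun r => V^T *m H r *m V).
Proof.
rewrite tensor_form_conj tensor_form_sum.
by apply: eq_bigr => i _; exact: tensor_form_Diag.
Qed.

Theorem theorem5p1 (R : realType) (n k : nat) (c : regularity)
    (f : 'rV[R]_n -> R)
    (f_diff : forall x : 'rV[R]_n, times_differentiable c k f x) :
  (forall X : symM R n, Omega (lambda X) ->
    times_differentiable c k (f \o @lambda R n) X) /\
  (forall (s : nat), (1 <= s)%N -> (s < k)%N ->
    forall A : 'S_s -> 'rV[R]_n -> tensor R s n,
    (forall (sigma : 'S_s) (mu : 'rV[R]_n), Omega mu ->
      times_differentiable_tensor c (k - s) (A sigma) mu) ->
    (forall (X : symM R n) (V : 'M[R]_n),
      Omega (lambda X) -> diagonalizes V X ->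
      nabla_is_tensor (f \o @lambda R n) X
        (tensor_conj V
          (\sum_(sigma : 'S_s) Diag_perm sigma (A sigma (lambda X))))) ->
    forall (X : symM R n) (V : 'M[R]_n),
      Omega (lambda X) -> diagonalizes V X ->
      nabla_is_tensor (f \o @lambda R n) X
        (tensor_conj V
          (\sum_(sigma : 'S_s) \sum_(l < s.+1)
             Diag_perm (perm_ext sigma l)
               (tensor_ext (A sigma) l (lambda X))))).
Proof.
split=> [X sX|s _ sk A dA nablaE X V sX dV H].
  have fs : smooth_on c setT k f by move=> x _; exact: f_diff.
  exact: (smooth_on_comp_lambda fs sX).
rewrite pair_bigA (tensor_form_spectral
  (fun p : 'S_s * 'I_s.+1 => perm_ext p.1 p.2)
  (fun p => tensor_ext (A p.1) p.2 (lambda X))).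
rewrite -(pair_bigA _ (fun sigma l => diag_form (perm_ext sigma l)
  (tensor_ext (A sigma) l (lambda X)) (fun r => V^T *m \val (H r) *m V))).
pose H' r := H (lift ord_max r).
have dA1 sigma u : differentiable (fun x => A sigma x u) (lambda X).
  by apply: times_differentiable1 (dA sigma _ sX u); rewrite subn_gt0.
have := is_diff_fsum (index_enum 'S_s) (P := xpredT)
  (fun sigma _ => is_diff_diag_form sX dV dA1 sigma H').
set S := (fun y => \sum_(sigma <- _ | _) _) => dS.
have nearS : \forall Y \near X, nabla (f \o @lambda R n) Y H' = S Y.
  apply: filterS (near_eigenbasis sX dV) => Y [sY WY].
  rewrite (nablaE _ _ sY WY H') tensor_form_spectral.
  by [].
have [_ dE] := near_is_diff nearS dS.
have := congr1 (fun F => F (H ord_max)) dE.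
move=> E; apply: etrans E _; apply: eq_bigr => sigma _; apply: eq_bigr => l _.
congr diag_form; apply/funext => r.
by case: unliftP => [r'|] ->.
Qed.
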